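(* Let $p$ be an odd prime. Let $I$ be the proportion of monic degree-$4$ polynomials in $\mathbb{Z}_p[x]$ that are irreducible. Then $$I=\frac{p^{12}+p^{11}+2p^{10}+4p^9-2p^8+p^7+3p^6-6p^5+6p^4-4p^3-2p^2-4}{4(p+1)(p^2+1)(p^9-1)}.$$
   Context: Monic quartics $x^4+c_3x^3+c_2x^2+c_1x+c_0$ are identified with points of $\mathbb{Z}_p^4$, which carries normalized Haar measure. The proportion of irreducibles is the Haar measure of the set of irreducible monic quartics. Irreducible means not a product of two nonconstant polynomials in $\mathbb{Z}_p[x]$. *)

(* Defs.v *)
From HB Require Import structures.
From mathcomp Require Import all_boot all_order all_algebra.
From mathcomp Require Import boolp classical_sets reals ereal sequences.
Set Implicit Arguments. Unset Strict Implicit. Unset Printing Implicit Defensive.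
Import Order.TTheory GRing.Theory Num.Theory.
Local Open Scope ring_scope.

(* The ring Z_p of p-adic integers, as the inverse limit of Z/p^n Z:   *)
(* an element is a coherent sequence (x n)_n of residues, x n being    *)
(* the canonical representative in [0, p^n) of the class mod p^n, with *)
(* x n = x (n+1) mod p^n.  (As for mathcomp's 'Z_p, the base is        *)
(* maxn p 2, so that the type is a nontrivial ring for every p; for    *)
(* p prime, maxn p 2 = p.)                                            *)

Definition zp_base (p : nat) : nat := maxn p 2.
Definition zp_mod (p n : nat) : int := ((zp_base p) ^ n)%N%:Z.

Definition zp_valid (p : nat) (x : nat -> int) : Prop :=
  forall n, x n = (x n.+1 %% zp_mod p n)%Z.

Record Zpadic (p : nat) := MkZp { zpval : nat -> int; zpvalP : zp_valid p zpval }.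

HB.instance Definition _ p := gen_eqMixin (Zpadic p).
HB.instance Definition _ p := gen_choiceMixin (Zpadic p).

Section ZpRing.
Variable p : nat.
Local Notation M := (zp_mod p).

Lemma zp_eq (x y : Zpadic p) : (forall n, zpval x n = zpval y n) -> x = y.
Proof.
case: x y => [x hx] [y hy] /= h.
have exy : x = y by apply: funext.
subst y; congr MkZp; exact: Prop_irrelevance.
Qed.

Lemma mod_mod_dvd (m d e : int) : (d %| e)%Z -> modz (modz m e) d = modz m d.
Proof. by move=> /dvdzP [k ->]; rewrite {2}(divz_eq m (k * d)) mulrA modzMDl. Qed.

Lemma zp_mod_dvd n : (M n %| M n.+1)%Z.
Proof.
apply/dvdzP; exists (zp_base p)%:Z.
by rewrite /zp_mod expnS PoszM mulrC.
Qed.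

Lemma zp_vmod (x : Zpadic p) n : (zpval x n %% M n)%Z = zpval x n.
Proof. by case: x => x hx /=; rewrite {2}(hx n) hx modz_mod. Qed.

Definition zp_zero : Zpadic p := @MkZp p (fun=> 0) (fun n => esym (mod0z _)).

Lemma zp_one_valid : zp_valid p (fun n => (1 %% M n)%Z).
Proof. by move=> n; rewrite mod_mod_dvd // zp_mod_dvd. Qed.
Definition zp_one : Zpadic p := MkZp zp_one_valid.

Lemma zp_add_valid (x y : Zpadic p) :
  zp_valid p (fun n => (zpval x n + zpval y n) %% M n)%Z.
Proof.
move=> n; rewrite mod_mod_dvd ?zp_mod_dvd //.
case: x y => [x hx] [y hy] /=.
by rewrite [x n]hx [y n]hy modzDml modzDmr.
Qed.
Definition zp_add (x y : Zpadic p) : Zpadic p := MkZp (zp_add_valid x y).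

Lemma zp_opp_valid (x : Zpadic p) : zp_valid p (fun n => (- zpval x n) %% M n)%Z.
Proof.
move=> n; rewrite mod_mod_dvd ?zp_mod_dvd //.
case: x => [x hx] /=.
by rewrite [x n]hx modzNm.
Qed.
Definition zp_opp (x : Zpadic p) : Zpadic p := MkZp (zp_opp_valid x).

Lemma zp_mul_valid (x y : Zpadic p) :
  zp_valid p (fun n => (zpval x n * zpval y n) %% M n)%Z.
Proof.
move=> n; rewrite mod_mod_dvd ?zp_mod_dvd //.
case: x y => [x hx] [y hy] /=.
by rewrite [x n]hx [y n]hy modzMml modzMmr.
Qed.
Definition zp_mul (x y : Zpadic p) : Zpadic p := MkZp (zp_mul_valid x y).

Lemma zp_addA : associative zp_add.
Proof. by move=> x y z; apply: zp_eq => n /=; rewrite modzDml modzDmr addrA. Qed.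
Lemma zp_addC : commutative zp_add.
Proof. by move=> x y; apply: zp_eq => n /=; rewrite addrC. Qed.
Lemma zp_add0 : left_id zp_zero zp_add.
Proof. by move=> x; apply: zp_eq => n /=; rewrite add0r zp_vmod. Qed.
Lemma zp_addN : left_inverse zp_zero zp_opp zp_add.
Proof. by move=> x; apply: zp_eq => n /=; rewrite modzDml addNr mod0z. Qed.

HB.instance Definition _ := GRing.isZmodule.Build (Zpadic p) zp_addA zp_addC zp_add0 zp_addN.

Lemma zp_mulA : associative zp_mul.
Proof. by move=> x y z; apply: zp_eq => n /=; rewrite modzMml modzMmr mulrA. Qed.
Lemma zp_mulC : commutative zp_mul.
Proof. by move=> x y; apply: zp_eq => n /=; rewrite mulrC. Qed.
Lemma zp_mul1 : left_id zp_one zp_mul.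
Proof. by move=> x; apply: zp_eq => n /=; rewrite modzMml mul1r zp_vmod. Qed.
Lemma zp_mulDl : left_distributive zp_mul zp_add.
Proof.
by move=> x y z; apply: zp_eq => n /=; rewrite modzMml modzDml modzDmr mulrDl.
Qed.
Lemma zp_one_neq0 : zp_one != zp_zero.
Proof.
apply/eqP => h; have := congr1 (fun x => zpval x 1) h => /=.
rewrite /zp_mod expn1 modz_small ?ltz_nat //.
by rewrite /zp_base leq_max ltnSn orbT.
Qed.

HB.instance Definition _ :=
  GRing.Zmodule_isComNzRing.Build (Zpadic p) zp_mulA zp_mulC zp_mul1 zp_mulDl zp_one_neq0.

End ZpRing.

Definition monic_quartic p (c : 'I_4 -> Zpadic p) : {poly Zpadic p} :=
  'X^4 + \sum_(i < 4) c i *: 'X^i.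

Definition zp_irreducible p (P : {poly Zpadic p}) : Prop :=
  ~ exists f g : {poly Zpadic p}, (1 < size f)%N /\ (1 < size g)%N /\ P = f * g.

(* Normalized Haar measure on Z_p^4.  The balls of Z_p^4 are the sets  *)
(* a + p^n Z_p^4 = {x | x_i = a_i mod p^n for all i}, of Haar measure  *)
(* p^(-4n); the Haar measure is the (Caratheodory) outer measure        *)
(* generated by this premeasure on balls: the infimum, over countable  *)
(* covers of A by balls, of the sum of the volumes.                    *)

Definition zp_ball4 p (a : 'I_4 -> Zpadic p) (n : nat) : set ('I_4 -> Zpadic p) :=
  [set x | forall i, zpval (x i) n = zpval (a i) n].

Local Open Scope ereal_scope.
Definition haar4 (R : realType) p (A : set ('I_4 -> Zpadic p)) : \bar R :=
  ereal_inf [set s : \bar R | exists (a : nat -> 'I_4 -> Zpadic p) (N : nat -> nat),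
     (A `<=` \bigcup_k zp_ball4 (a k) (N k))%classic /\
     s = \sum_(0 <= k <oo) ((p%:R ^+ (4 * N k))^-1 : R)%:E].

(* Main.v *)
(* Since 4 is a unit, a quartic is [((x + u)^2 - v)^2 - s (x + u) - t] for unique
   [u, v, s, t], and the change of variables preserves the measure. Reduce the depressed
   quartic modulo [p]: if it is irreducible, so is the quartic, and if it is not a power of
   an irreducible polynomial, the quartic splits by Hensel's lemma. Two cases remain.
   When it is the square of an irreducible quadratic, [t + s sqrt v] decides at its first
   nonzero digit: odd valuations and nonsquares are irreducible. When it is [y^4], the
   coefficients [t, s, t, v, s, t] are examined in turn modulo [p]; each time the outcome is
   decided unless the coefficient vanishes, except for one ramified branch similar to the
   previous case, and after six steps [(v, s, t)] has become [(p^2 v, p^3 s, p^4 t)], which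
   is the original problem. So the density [I] satisfies an affine equation in which its
   coefficient is [p^-9]. The irreducible quartics over [F_p] are counted by
   inclusion-exclusion on the roots and by removing the products of two irreducible
   quadratics. For the Haar measure it suffices to cover the set and its complement by
   finitely many balls of total volume [I + e] and [1 - I + e]. *)
Require Import Defs.
From HB Require Import structures.
From mathcomp Require Import all_boot all_order all_algebra.
From mathcomp Require Import boolp classical_sets reals ereal sequences.
From mathcomp Require Import filter topology normedtype.
From mathcomp Require Import ring lra zify.
Set Implicit Arguments. Unset Strict Implicit. Unset Printing Implicit Defensive.
Import Order.TTheory GRing.Theory Num.Theory.
Local Open Scope ring_scope.

(** Without the term [4 k^4], the equations [s = 4 k l] and [t = l^2 + 4 v k^2 - 4 k^4] say that
    [t + s sqrt v] is the square of [l + 2 k sqrt v]. In the degenerate branches powers of [pi] make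
    that term negligible, which is why squares in a quadratic extension decide. The extension is
    never constructed: [k] and [l] serve as coordinates in it. The recursion and its two side
    branches go on forever on a null set of quartics, so no finite stage gives an exact density.
    Every density is therefore stated with an error on both sides, and each self-reference at least
    halves that error. The algebra takes place in an abstract ring with residue field [F];
    completeness is used only as a fixed point principle, from which both forms of Hensel's lemma
    follow. *)

(* The depressed quartic [(y^2 - v)^2 - s y - t] has a root, or is the product
   of [y^2 + 2 k y + (2 k^2 - v + l)] and [y^2 - 2 k y + (2 k^2 - v - l)]. *)
Definition splits (A : comNzRingType) (v s t : A) : Prop :=
  (exists r, (r ^+ 2 - v) ^+ 2 = s * r + t) \/
  (exists k l, s = 4 * k * l /\ t = l ^+ 2 + 4 * v * k ^+ 2 - 4 * k ^+ 4).

Definition is_square (A : comNzRingType) (v : A) : Prop := exists w, v = w ^+ 2.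

(* [t + s \sqrt v] is a square in the quadratic extension generated by [\sqrt v]. *)
Definition square_pair (A : comNzRingType) (v s t : A) : Prop :=
  exists k l, s = 4 * k * l /\ t = l ^+ 2 + 4 * v * k ^+ 2.

(** * Congruences modulo powers of a uniformizer, and henselian rings *)

Definition congruent (A : comNzRingType) (pi : A) (n : nat) (x y : A) : Prop :=
  exists z, x = y + pi ^+ n * z.

Section Congruent.
Variables (A : comNzRingType) (pi : A) (n : nat).
Local Notation cg := (congruent pi n).

Lemma congruent_refl x : cg x x.
Proof. by exists 0; rewrite mulr0 addr0. Qed.

Lemma congruentD x y x' y' : cg x x' -> cg y y' -> cg (x + y) (x' + y').
Proof. by case=> z -> [w ->]; exists (z + w); ring. Qed.

Lemma congruentN x x' : cg x x' -> cg (- x) (- x').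
Proof. by case=> z ->; exists (- z); ring. Qed.

Lemma congruentM x y x' y' : cg x x' -> cg y y' -> cg (x * y) (x' * y').
Proof.
by case=> z -> [w ->]; exists (x' * w + z * y' + pi ^+ n * z * w); ring.
Qed.

Lemma congruentX m x x' : cg x x' -> cg (x ^+ m) (x' ^+ m).
Proof.
move=> h; elim: m => [|m ih]; first by rewrite !expr0; apply: congruent_refl.
by rewrite !exprS; apply: congruentM.
Qed.

End Congruent.

Ltac congruence_of_polynomials :=
  repeat first [ assumption | apply: congruentD | apply: congruentN
    | apply: congruentM | apply: congruentX | apply: congruent_refl ].

(** Completeness enters through [fixpoint]: maps that respect congruences at every level become
    contractions once multiplied by [pi]. Two unknowns are provided because a factorization has the
    two parameters [k] and [l]; polynomial maps respect congruences automatically. *)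
Record henselian (A : comNzRingType) (F : finFieldType) (pi : A)
    (rs : {rmorphism A -> F}) (lift : F -> A) : Prop := Henselian {
  res_lift : forall a, rs (lift a) = a;
  lift_zero : lift 0 = 0;
  res_pi : rs pi = 0;
  res_eq0 : forall x, rs x = 0 -> exists y, x = pi * y;
  pi_inj : forall x y, pi * x = pi * y -> x = y;
  res_unit : forall x, rs x != 0 -> exists y, x * y = 1;
  fixpoint : forall (c d : A) (f g : A -> A -> A),
    (forall n x y x' y', congruent pi n x x' -> congruent pi n y y' ->
       congruent pi n (f x y) (f x' y')) ->
    (forall n x y x' y', congruent pi n x x' -> congruent pi n y y' ->
       congruent pi n (g x y) (g x' y')) ->
    exists x y, x = c + pi * f x y /\ y = d + pi * g x y }.

(** * Hensel lifting of roots and of quadratic factorizations *)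

Section Splitting.
Variables (A : comNzRingType) (F : finFieldType) (pi : A).
Variables (rs : {rmorphism A -> F}) (lift : F -> A).
Hypothesis HR : henselian pi rs lift.
Hypothesis F2 : (2 : F) != 0.

Lemma res_num n : rs n%:R = n%:R. Proof. exact: rmorph_nat. Qed.

Definition resE := (res_pi HR, rmorphD, rmorphM, rmorphN, rmorphXn, res_num, rmorph0, rmorph1).

Lemma four_neq0 : (4 : F) != 0.
Proof. by rewrite (_ : 4 = 2 * 2); [rewrite mulf_neq0|ring]. Qed.

Lemma res_split x r : rs x = r -> exists y, x = lift r + pi * y.
Proof.
move=> e; case: (@res_eq0 _ _ _ _ _ HR (x - lift r)).
  by rewrite rmorphB e (res_lift HR) subrr.
by move=> y hy; exists y; rewrite -hy; ring.
Qed.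

Lemma pi_dvd x r : rs x = rs r -> exists y, x = r + pi * y.
Proof.
move=> e; case: (@res_eq0 _ _ _ _ _ HR (x - r)); first by rewrite rmorphB e subrr.
by move=> y hy; exists y; rewrite -hy; ring.
Qed.

(** Newton's method: for [r = r0 + pi x] the linear term has the derivative at [r0], a unit, as
    coefficient, and the Taylor remainder is divisible by [pi^2], so [x] solves a fixed point
    equation. The factors [c] and [e] absorb the powers of [pi] left by a substitution
    [y = pi r]. *)
Lemma hensel_root c e g s t r0 :
  rs (c * (e * r0 ^+ 2 - g) ^+ 2) = rs (s * r0 + t) ->
  rs (4 * c * e * r0 * (e * r0 ^+ 2 - g) - s) != 0 ->
  exists r, c * (e * r ^+ 2 - g) ^+ 2 = s * r + t.
Proof.
move=> h0 /(res_unit HR) [w hw].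
have [F0 hF0] := pi_dvd h0.
pose E0 := e * r0 ^+ 2 - g.
have [||x [y [hx _]]] := fixpoint HR (- w * F0) 0
   (f := fun x _ => - w * (2 * c * E0 * e * x ^+ 2
       + c * (2 * e * r0 * x + pi * e * x ^+ 2) ^+ 2)) (g := fun x _ => x).
- by move=> n *; congruence_of_polynomials.
- by [].
exists (r0 + pi * x).
have hx' : (4 * c * e * r0 * (e * r0 ^+ 2 - g) - s) * x = - (F0 + pi * (2 * c * E0 * e * x ^+ 2
       + c * (2 * e * r0 * x + pi * e * x ^+ 2) ^+ 2)).
  rewrite [in LHS]hx -[RHS]mul1r -[X in _ = X * _]hw /E0; ring.
apply/eqP; rewrite -subr_eq0; apply/eqP.
transitivity ((c * (e * r0 ^+ 2 - g) ^+ 2 - (s * r0 + t)) + pi * ((4 * c * e * r0 * (e * r0 ^+ 2 - g) - s) * x) + pi * (pi * (2 * c * E0 * e * x ^+ 2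
       + c * (2 * e * r0 * x + pi * e * x ^+ 2) ^+ 2))).
  by rewrite /E0; ring.
by rewrite hx' hF0; ring.
Qed.

(** The unit condition is one eighth of the Jacobian determinant of [(k, l) -> (4 k l, a l^2 + 4 b
    k^2 - 4 e k^4)]. For [a = e = 1] and [b = v] it is a quarter of the resultant of the two
    quadratic factors, so it asks that they be coprime modulo [pi]. The weights [a], [b], [e] carry
    the powers of [pi] left by a rescaling of [k] and [l]. *)
Lemma hensel_pair a b e s t k0 l0 :
  rs s = rs (4 * k0 * l0) ->
  rs t = rs (a * l0 ^+ 2 + 4 * b * k0 ^+ 2 - 4 * e * k0 ^+ 4) ->
  rs (a * l0 ^+ 2 - 4 * b * k0 ^+ 2 + 8 * e * k0 ^+ 4) != 0 ->
  exists k l, s = 4 * k * l /\ t = a * l ^+ 2 + 4 * b * k ^+ 2 - 4 * e * k ^+ 4.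
Proof.
move=> hs ht hD.
pose B := 8 * b * k0 - 16 * e * k0 ^+ 3.
have : rs (8 * a * l0 ^+ 2 - 4 * k0 * B) != 0.
  rewrite (_ : 8 * _ * _ - _ = 2 ^+ 3 * (a * l0 ^+ 2 - 4 * b * k0 ^+ 2 + 8 * e * k0 ^+ 4)).
    by rewrite rmorphM mulf_neq0 // rmorphXn res_num expf_neq0.
  by rewrite /B; ring.
move/(res_unit HR) => [w hw].
have [S hS] := pi_dvd hs.
have [T hT] := pi_dvd ht.
(* [Q] is the part of order at least two of the second equation expanded at [(k0, l0)], divided by
   [pi^2]; [B] is the derivative in [k]. The system below is Cramer's rule with the inverse [w] of
   the determinant. *)
pose Q x y := a * y ^+ 2 + 4 * b * x ^+ 2
   - 4 * e * (6 * k0 ^+ 2 * x ^+ 2 + 4 * pi * k0 * x ^+ 3 + pi ^+ 2 * x ^+ 4).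
have [||x [y [hx hy]]] := fixpoint HR (w * (2 * a * l0 * S - 4 * k0 * T))
   (w * (4 * l0 * T - B * S))
   (f := fun x y => w * (4 * k0 * Q x y - 8 * a * l0 * x * y))
   (g := fun x y => w * (4 * B * x * y - 4 * l0 * Q x y)).
- by move=> n *; rewrite /Q; congruence_of_polynomials.
- by move=> n *; rewrite /Q; congruence_of_polynomials.
have e1 : 4 * l0 * x + 4 * k0 * y = S - 4 * pi * x * y.
  apply: etrans (f_equal2 (fun a b => 4 * l0 * a + 4 * k0 * b) hx hy) _.
  rewrite -[RHS]mul1r -[X in _ = X * _]hw; ring.
have e2 : B * x + 2 * a * l0 * y = T - pi * Q x y.
  apply: etrans (f_equal2 (fun z b => B * z + 2 * a * l0 * b) hx hy) _.
  rewrite -[RHS]mul1r -[X in _ = X * _]hw; ring.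
exists (k0 + pi * x), (l0 + pi * y); split.
  rewrite hS (_ : S = 4 * l0 * x + 4 * k0 * y + 4 * pi * x * y); first by ring.
  by rewrite e1; ring.
rewrite hT (_ : T = B * x + 2 * a * l0 * y + pi * Q x y); first by rewrite /B /Q; ring.
by rewrite e2; ring.
Qed.

End Splitting.

(** * Criteria for splitting and for irreducibility, branch by branch *)

Section Criteria.
Variables (A : comNzRingType) (F : finFieldType) (pi : A).
Variables (rs : {rmorphism A -> F}) (lift : F -> A).
Hypothesis HR : henselian pi rs lift.
Hypothesis F2 : (2 : F) != 0.

Local Notation resE := (res_pi HR, rmorphD, rmorphM, rmorphN, rmorphXn, res_num, rmorph0, rmorph1).

Lemma mul4_eq0 (k l : F) : 4 * k * l = 0 -> k = 0 \/ l = 0.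
Proof.
move/eqP; rewrite !mulf_eq0 (negbTE (four_neq0 F2)) /= => /orP[]/eqP ->; by [left|right].
Qed.

Lemma sqr_eq0 (k : F) n : k ^+ n.+1 = 0 -> k = 0.
Proof. by move/eqP; rewrite expf_eq0 /= => /eqP. Qed.

Lemma pi_dvd2 (k l : A) : rs k = 0 -> rs l = 0 ->
  exists k' l', k = pi * k' /\ l = pi * l'.
Proof. by move=> /(res_eq0 HR)[k' ->] /(res_eq0 HR)[l' ->]; exists k', l'. Qed.

Lemma splits_residue v s t : splits v s t -> splits (rs v) (rs s) (rs t).
Proof.
case=> [[r h]|[k [l [hs ht]]]].
  by left; exists (rs r); have := congr1 rs h; rewrite !resE.
by right; exists (rs k), (rs l); rewrite hs ht !resE.
Qed.

(** The excluded residues are the powers of irreducible polynomials: [y^4], and [(y^2 - v)^2] with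
    [v] a nonsquare. Any other reducible residue has a simple root or two coprime quadratic factors,
    which can be lifted. *)
Lemma splits_of_residue v s t :
  splits (rs v) (rs s) (rs t) ->
  ~ (rs s = 0 /\ rs t = 0 /\ (rs v = 0 \/ ~ is_square (rs v))) -> splits v s t.
Proof.
move=> hsp hdeg.
have hpair k l : rs s = 4 * k * l -> rs t = l ^+ 2 + 4 * rs v * k ^+ 2 - 4 * k ^+ 4 ->
    l ^+ 2 - 4 * rs v * k ^+ 2 + 8 * k ^+ 4 != 0 -> splits v s t.
  move=> hs ht hD; right.
  have := @hensel_pair _ _ _ _ _ HR F2 1 v 1 s t (lift k) (lift l).
  rewrite !resE !(res_lift HR) -hs !mul1r !mulr1 -ht => /(_ erefl erefl hD) [k1 [l1 [-> ->]]].
  by exists k1, l1; split => //; ring.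
have hroot r : (r ^+ 2 - rs v) ^+ 2 = rs s * r + rs t ->
    4 * r * (r ^+ 2 - rs v) - rs s != 0 -> splits v s t.
  move=> h hD; left.
  have := @hensel_root _ _ _ _ _ HR 1 1 v s t (lift r).
  rewrite !resE !(res_lift HR) !mul1r !mulr1 => /(_ h hD) [r1 h1].
  by exists r1; rewrite -h1; ring.
have two k l : rs s = 4 * k * l -> rs t = l ^+ 2 + 4 * rs v * k ^+ 2 - 4 * k ^+ 4 -> splits v s t.
  move=> hs ht; case: (eqVneq (l ^+ 2 - 4 * rs v * k ^+ 2 + 8 * k ^+ 4) 0) => [hD|]; last exact: hpair hs ht.
  case: (eqVneq k 0) => [k0|k0].
    have l0 : l = 0 by apply: (@sqr_eq0 l 1); rewrite -hD k0; ring.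
    have s0 : rs s = 0 by rewrite hs k0; ring.
    have t0 : rs t = 0 by rewrite ht k0 l0; ring.
    case: (pselect (is_square (rs v))) => [[w hw]|hn]; last first.
      by case: hdeg; split=> //; split=> //; right.
    case: (eqVneq w 0) => [w0|w0].
      by case: hdeg; split=> //; split=> //; left; rewrite hw w0; ring.
    (* Regroup [(y^2 - w^2)^2] as [(y + w)^2 (y - w)^2], whose factors are coprime. *)
    apply: (hpair w 0); rewrite ?s0 ?t0 ?hw; try ring.
    rewrite (_ : _ + _ = 4 * w ^+ 4); last by ring.
    by rewrite mulf_neq0 ?four_neq0 // expf_neq0.
  (* The common root of the two factors is at least double; the other
     root of one of them is then simple. *)
  have hv : 4 * rs v * k ^+ 2 = l ^+ 2 + 8 * k ^+ 4 by apply/eqP; rewrite -subr_eq0 -oppr_eq0 -hD; apply/eqP; ring.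
  have k4 : 4 * k ^+ 2 != 0 by rewrite mulf_neq0 ?four_neq0 // expf_neq0.
  pose r := - l / (2 * k).
  have k2 : 2 * k != 0 by rewrite mulf_neq0.
  have hl : l = - 2 * k * r by rewrite /r; field; rewrite k0 F2.
  have hv' : rs v = r ^+ 2 + 2 * k ^+ 2.
    apply: (mulfI k4); transitivity (4 * rs v * k ^+ 2); first by ring.
    by rewrite hv hl; ring.
  have ht' : rs t = 12 * k ^+ 2 * r ^+ 2 - 4 * k ^+ 2 * r ^+ 2 + 4 * k ^+ 4.
    by rewrite ht hv' hl; ring.
  have hs' : rs s = - 8 * k ^+ 2 * r by rewrite hs hl; ring.
  (* The roots are [r], [r], [2 k - r] and [- 2 k - r]. The third is simple unless [k = r]; then [r]
     is triple and the last root, [- 3 r], is simple. *)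
  case: (eqVneq k r) => [kr|kr].
    apply: (hroot (- 2 * k - r)); rewrite ?ht' hs' hv' -kr; first by ring.
    rewrite (_ : _ - _ = - (2 ^+ 6) * k ^+ 3); last by ring.
    by rewrite mulf_neq0 ?oppr_eq0 ?expf_neq0.
  apply: (hroot (2 * k - r)); rewrite ?ht' hs' hv'; first by ring.
  rewrite (_ : _ - _ = 2 ^+ 4 * k * (k - r) ^+ 2); last by ring.
  by rewrite !mulf_neq0 ?expf_neq0 // subr_eq0.
case: hsp => [[r h]|[k [l [hs ht]]]]; last exact: two hs ht.
case: (eqVneq (4 * r * (r ^+ 2 - rs v) - rs s) 0) => [hD|]; last exact: hroot.
have hs : rs s = 4 * r * (r ^+ 2 - rs v) by apply/esym/eqP; rewrite -subr_eq0 hD.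
(* At a multiple root [r], the square [(y - r)^2] is one of the two quadratic factors. *)
apply: (two (- r) (rs v - r ^+ 2)); first by rewrite hs; ring.
by rewrite -[LHS](addKr (rs s * r)) -h hs; ring.
Qed.

(** A descent: as [v] is not a square, the equations modulo [pi] force [pi] to divide [k] and [l].
    Dividing by [pi^2] lowers [n] by two and turns [mu] into [pi mu], which records how the quartic
    term fades. At [n = 1] both [s] and [t] would vanish modulo [pi]; at [n = 0] they would form a
    square. *)
Lemma inert_not_splits n v s t mu k l :
  ~ is_square (rs v) ->
  (if odd n then rs s != 0 \/ rs t != 0 else ~ square_pair (rs v) (rs s) (rs t)) ->
  (n = 0%N -> rs mu = 0) ->
  pi ^+ n * s = 4 * k * l ->
  pi ^+ n * t = l ^+ 2 + 4 * v * k ^+ 2 - 4 * mu ^+ 2 * k ^+ 4 -> False.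
Proof.
move=> hv; elim/ltn_ind: n mu k l => -[|n] ih mu k l hst hmu hs ht.
  apply: hst; exists (rs k), (rs l).
  have := congr1 rs hs; have := congr1 rs ht; rewrite !resE expr0 !mul1r => -> ->.
  by rewrite (hmu erefl); split; ring.
have := congr1 rs hs; have := congr1 rs ht; rewrite !resE !exprS !mul0r => e1 e2.
have [k0 l0] : rs k = 0 /\ rs l = 0.
  case: (mul4_eq0 (esym e2)) => h0.
    by split=> //; apply: (@sqr_eq0 _ 1); rewrite [RHS]e1 h0; ring.
  split=> //; apply/eqP; apply/negPn/negP => k0; apply: hv; exists (rs mu * rs k).
  have k4 : 4 * rs k ^+ 2 != 0 by rewrite mulf_neq0 ?four_neq0 // expf_neq0.
  apply: (mulfI k4); apply/eqP; rewrite -subr_eq0; apply/eqP.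
  by rewrite [RHS]e1 h0; ring.
have [k' [l' [hk hl]]] := pi_dvd2 k0 l0; subst k l.
case: n ih hst hmu hs ht {e1 e2} => [|n] ih hst hmu hs ht.
  have [h|h] := hst; move/negP: h; apply; apply/eqP.
    rewrite (_ : s = pi * (4 * k' * l')) ?resE ?mul0r //.
    by apply: (pi_inj HR); rewrite -[pi * s]/(pi ^+ 1 * s) hs; ring.
  rewrite (_ : t = pi * (l' ^+ 2 + 4 * v * k' ^+ 2 - 4 * pi ^+ 2 * mu ^+ 2 * k' ^+ 4)) ?resE ?mul0r //.
  by apply: (pi_inj HR); rewrite -[pi * t]/(pi ^+ 1 * t) ht; ring.
apply: (ih n _ (pi * mu) k' l') => //.
- by move: hst; rewrite /= negbK.
- by rewrite !resE mul0r.
- apply: (pi_inj HR); apply: (pi_inj HR); transitivity (pi ^+ n.+2 * s); first by rewrite !exprS !mulrA.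
  by rewrite hs; ring.
apply: (pi_inj HR); apply: (pi_inj HR); transitivity (pi ^+ n.+2 * t); first by rewrite !exprS !mulrA.
by rewrite ht; ring.
Qed.

Lemma inert_irreducible n v s t :
  ~ is_square (rs v) ->
  (if odd n.+1 then rs s != 0 \/ rs t != 0 else ~ square_pair (rs v) (rs s) (rs t)) ->
  ~ splits v (pi ^+ n.+1 * s) (pi ^+ n.+1 * t).
Proof.
move=> hv hst [[r]|[k [l [hs ht]]]].
  move/(congr1 rs); rewrite !resE expr0n /= !mul0r addr0 => /(@sqr_eq0 _ 1) /eqP.
  by rewrite subr_eq0 => /eqP h; apply: hv; exists (rs r).
by apply: (@inert_not_splits n.+1 v s t 1 k l hv hst) => //; rewrite ht; ring.
Qed.

(** Lifting requires that the norm [l^2 - 4 v k^2] of [l + 2 k sqrt v] be nonzero; it is, because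
    the square of this element is nonzero and [v] is not a square. The quartic term keeps a positive
    power of [pi], here [e], and vanishes modulo [pi]. *)
Lemma inert_splits j v s t :
  ~ is_square (rs v) -> square_pair (rs v) (rs s) (rs t) ->
  rs s != 0 \/ rs t != 0 ->
  splits v (pi ^+ (j.+1 + j.+1) * s) (pi ^+ (j.+1 + j.+1) * t).
Proof.
move=> hv [k [l [hs ht]]] hst; right.
have hD : l ^+ 2 - 4 * rs v * k ^+ 2 != 0.
  apply/eqP => hD; case: (eqVneq k 0) => [k0|k0].
    have l0 : l = 0 by apply: (@sqr_eq0 l 1); rewrite -hD k0; ring.
    by move: hst; rewrite hs ht k0 l0 !(mulr0, mul0r, addr0, expr0n) /= eqxx; case.
  apply: hv; exists (l / (2 * k)); apply/eqP.
  have k4 : 4 * k ^+ 2 != 0 by rewrite mulf_neq0 ?four_neq0 // expf_neq0.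
  rewrite -(inj_eq (mulfI k4)) -subr_eq0 -oppr_eq0 -hD; apply/eqP; field.
  by rewrite k0 F2.
have [e [ed re]] : exists e, e = pi ^+ (j.+1 + j.+1) /\ rs e = 0.
  by eexists; split; first by []; rewrite rmorphXn (res_pi HR) expr0n.
have := @hensel_pair _ _ _ _ _ HR F2 1 v e s t (lift k) (lift l).
rewrite !resE !(res_lift HR) re !(mulr0, mul0r, mul1r, subr0, addr0) => /(_ hs ht hD) [k1 [l1 [e1 e2]]].
exists (pi ^+ j.+1 * k1), (pi ^+ j.+1 * l1); rewrite e1 e2 ed !exprD; split; ring.
Qed.

(** Used with [w = 4 k^3] when the quartic is [y^4] modulo [pi]: both quadratic factors then reduce
    to [y^2], so [pi] divides [k] and [l]. *)
Lemma res_both0 (k l : A) w : 4 * rs k * rs l = 0 ->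
  rs l ^+ 2 = w * rs k -> (rs l = 0 -> w = 0 -> rs k = 0) -> rs k = 0 /\ rs l = 0.
Proof.
move=> /mul4_eq0 [k0 e _|l0 e h]; split=> //.
  by apply: (@sqr_eq0 _ 1); rewrite e k0 mulr0.
have /eqP : w * rs k = 0 by rewrite -e l0 expr0n.
by rewrite mulf_eq0 => /orP[]/eqP // w0; exact: h.
Qed.

Lemma eisenstein_irreducible v s t : rs t != 0 -> ~ splits (pi * v) (pi * s) (pi * t).
Proof.
move/eqP=> ht0 [[r h]|[k [l [hs ht]]]]; apply: ht0.
  have /(@sqr_eq0 _ 3) /(res_eq0 HR) [r' e] : rs r ^+ 4 = 0.
    by have h' := congr1 rs h; rewrite !resE in h'; apply: etrans (etrans h' _); ring.
  rewrite (_ : t = pi * ((pi * r' ^+ 2 - v) ^+ 2 - s * r')) ?resE ?mul0r //.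
  apply: (pi_inj HR); apply/(addrI (pi * s * r)); rewrite -h e; ring.
have := congr1 rs hs; have := congr1 rs ht; rewrite !resE !(mul0r, mulr0) => e1 e2.
have [||k0 l0] := @res_both0 k l (4 * rs k ^+ 3) (esym e2).
- by apply/eqP; rewrite -subr_eq0 [X in _ == X]e1; apply/eqP; ring.
- by move=> _ /eqP; rewrite mulf_eq0 (negbTE (four_neq0 F2)) /= expf_eq0 /= => /eqP.
have [k' [l' [hk hl]]] := pi_dvd2 k0 l0; subst k l.
rewrite (_ : t = pi * (l' ^+ 2 + 4 * pi * v * k' ^+ 2 - 4 * pi ^+ 2 * k' ^+ 4)) ?resE ?mul0r //.
by apply: (pi_inj HR); rewrite ht; ring.
Qed.

(** Substituting [y = pi r] and dividing by [pi^2] leaves [(pi r^2 - v)^2 = s r + t], which modulo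
    [pi] is linear in [r] with unit slope. *)
Lemma simple_root_splits v s t : rs s != 0 -> splits (pi * v) (pi * s) (pi ^+ 2 * t).
Proof.
move=> hs; have [w hw] := res_unit HR hs.
have [] := @hensel_root _ _ _ _ _ HR 1 pi v s t (lift (rs (w * (v ^+ 2 - t)))).
- rewrite !(res_lift HR, res_pi HR, rmorphD, rmorphM, rmorphN, rmorphXn, res_num, rmorph1) !(mul0r, mul1r) ?sub0r.
  have := congr1 rs hw; rewrite !resE => hw'.
  by rewrite mulrA hw'; ring.
- by rewrite !resE !(mul0r, mulr0) sub0r oppr_eq0.
by move=> r h; left; exists (pi * r); transitivity (pi ^+ 2 * (1 * (pi * r ^+ 2 - v) ^+ 2)); [ring|rewrite h; ring].
Qed.

(** The Newton polygon has the single slope 1/2, and its residual polynomial in [Y = y^2 / pi] is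
    [(Y - v)^2 - t], irreducible when [t] is not a square. *)
Lemma split_pair_irreducible v s t : ~ is_square (rs t) ->
  ~ splits (pi * v) (pi ^+ 2 * s) (pi ^+ 2 * t).
Proof.
move=> hn [[r h]|[k [l [hs ht]]]]; apply: hn.
  have /(@sqr_eq0 _ 3) /(res_eq0 HR) [r' e] : rs r ^+ 4 = 0.
    by have h' := congr1 rs h; rewrite !resE in h'; apply: etrans (etrans h' _); ring.
  exists (rs v); have -> : t = (pi * r' ^+ 2 - v) ^+ 2 - s * r' * pi.
    apply: (pi_inj HR); apply: (pi_inj HR); apply/(addrI (pi ^+ 2 * s * r)).
    transitivity (pi ^+ 2 * s * r + pi ^+ 2 * t); [ring|rewrite -h e; ring].
  by rewrite !resE; ring.
have := congr1 rs hs; have := congr1 rs ht; rewrite !resE expr0n !(mul0r, mulr0) => e1 e2.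
have [||k0 l0] := @res_both0 k l (4 * rs k ^+ 3) (esym e2).
- by apply/eqP; rewrite -subr_eq0 [X in _ == X]e1; apply/eqP; ring.
- by move=> _ /eqP; rewrite mulf_eq0 (negbTE (four_neq0 F2)) /= expf_eq0 /= => /eqP.
have [k' [l' [hk hl]]] := pi_dvd2 k0 l0; subst k l.
exists (rs l'); rewrite (_ : t = l' ^+ 2 + 4 * pi * v * k' ^+ 2 - 4 * pi ^+ 2 * k' ^+ 4).
  by rewrite !resE; ring.
by apply: (pi_inj HR); apply: (pi_inj HR); transitivity (pi ^+ 2 * t); [ring|rewrite ht; ring].
Qed.

Lemma split_pair_splits j v s t : is_square (rs t) -> rs t != 0 ->
  splits (pi * v) (pi ^+ (j.+1 + j.+1) * s) (pi ^+ (j.+1 + j.+1) * t).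
Proof.
move=> [l ht] ht0; right.
have l0 : l != 0 by apply: contraNneq ht0 => l0; rewrite ht l0 expr0n.
have [e [ed re]] : exists e, e = pi ^+ (j.+1 + j.+1) /\ rs e = 0.
  by eexists; split; first by []; rewrite rmorphXn (res_pi HR) expr0n.
have := @hensel_pair _ _ _ _ _ HR F2 1 (pi * v) e s t (lift (rs s / (4 * l))) (lift l).
rewrite !resE !(res_lift HR) re !(mulr0, mul0r, mul1r, subr0, addr0) ht.
case=> //; first by field; rewrite l0 four_neq0.
  by rewrite expf_neq0.
move=> k1 [l1 [e1 e2]].
exists (pi ^+ j.+1 * k1), (pi ^+ j.+1 * l1); rewrite e1 e2 ed !exprD; split; ring.
Qed.

(** In the extension generated by [sqrt (pi v)], [pi] equals [v] up to a square, so at an odd level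
    [v t] takes the place of [t]. Taking [pi^(j+1)] out of [k] and [pi^(j+2)] out of [l] leaves
    [t = 4 v k^2] modulo [pi], which gives [k]; then [s] gives [l]. *)
Lemma ramified_splits j v s t : is_square (rs v * rs t) -> rs v != 0 -> rs t != 0 ->
  splits (pi * v) (pi ^+ (j.+1 + j.+2) * s) (pi ^+ (j.+1 + j.+2) * t).
Proof.
move=> [w ht] v0 t0; right.
have w0 : w != 0.
  by have := mulf_neq0 v0 t0; apply: contraNneq => w0; rewrite ht w0 expr0n.
have [e [ed re]] : exists e, e = pi ^+ (j + j).+1 /\ rs e = 0.
  by eexists; split; first by []; rewrite rmorphXn (res_pi HR) expr0n.
have := @hensel_pair _ _ _ _ _ HR F2 pi v e s t
   (lift (w / (2 * rs v))) (lift (rs s / (4 * (w / (2 * rs v))))).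
rewrite !(resE, res_lift HR) re !(mulr0, mul0r, mul1r, subr0, addr0, add0r, sub0r).
case.
- by field; rewrite w0 v0 F2 four_neq0.
- apply: (mulfI v0); rewrite ht; field; by rewrite v0 F2.
- by rewrite oppr_eq0 !mulf_neq0 ?four_neq0 ?expf_neq0 ?mulf_neq0 ?invr_neq0 ?mulf_neq0.
move=> k1 [l1 [e1 e2]].
exists (pi ^+ j.+1 * k1), (pi ^+ j.+2 * l1); rewrite e1 e2 ed !addSn !addnS !exprS !exprD; split; ring.
Qed.

(** When [sqrt (pi v)] has valuation 1, [pi^(n+1) t + pi^n s sqrt (pi v)] has the odd valuation
    [2 n + 1] and is not a square; the descent carries the quartic term along. *)
Lemma ramified_not_splits_s n v s t mu k l : rs v != 0 -> rs s != 0 ->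
  pi ^+ n * s = 4 * k * l ->
  pi ^+ n.+1 * t = l ^+ 2 + 4 * pi * v * k ^+ 2 - 4 * (pi * mu) ^+ 2 * k ^+ 4 -> False.
Proof.
move=> v0 s0; elim/ltn_ind: n mu k l => n ih mu k l hs ht.
have /(@sqr_eq0 _ 1) /(res_eq0 HR) [l' e] : rs l ^+ 2 = 0.
  have h' := congr1 rs ht; rewrite !resE exprS in h'; apply: etrans (etrans (esym h') _); ring.
subst l; case: n ih hs ht => [|n] ih hs ht.
  move/eqP: s0; apply; have h' := congr1 rs hs; rewrite !resE in h'.
  by apply: etrans (etrans h' _); ring.
have ht' : pi ^+ n.+1 * t = pi * l' ^+ 2 + 4 * v * k ^+ 2 - 4 * pi * mu ^+ 2 * k ^+ 4.
  apply: (pi_inj HR); transitivity (pi ^+ n.+2 * t); first by rewrite mulrA -exprS.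
  by rewrite ht; ring.
have /eqP : 4 * rs v * rs k ^+ 2 = 0.
  have h' := congr1 rs ht'; rewrite !resE exprS in h'; apply: etrans (etrans (esym h') _); ring.
rewrite !mulf_eq0 (negbTE (four_neq0 F2)) (negbTE v0) /= orbb => /eqP /(res_eq0 HR) [k' e]; subst k.
have hs' : pi ^+ n * s = pi * (4 * k' * l').
  by apply: (pi_inj HR); transitivity (pi ^+ n.+1 * s); [rewrite mulrA -exprS|rewrite hs; ring].
case: n ih hs ht ht' hs' => [|n] ih hs ht ht' hs'.
  move/eqP: s0; apply; have h' := congr1 rs hs'; rewrite !resE in h'.
  by apply: etrans (etrans h' _); ring.
apply: (ih n _ (pi * mu) k' l') => //.
  by apply: (pi_inj HR); rewrite -hs' mulrA -exprS.
apply: (pi_inj HR); transitivity (pi ^+ n.+2 * t); first by rewrite mulrA -exprS.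
by rewrite ht'; ring.
Qed.

(** Now [pi^(n+1) t] is the leading term, and each factor [pi] counts as [v] up to a square, hence
    the exponent [odd n.+1]. *)
Lemma ramified_not_splits_t n v s t mu k l : rs v != 0 ->
  ~ is_square (rs t * rs v ^+ odd n.+1) ->
  pi ^+ n.+1 * s = 4 * k * l ->
  pi ^+ n.+1 * t = l ^+ 2 + 4 * pi * v * k ^+ 2 - 4 * (pi * mu) ^+ 2 * k ^+ 4 -> False.
Proof.
move=> v0; elim/ltn_ind: n mu k l => n ih mu k l hn hs ht.
have /(@sqr_eq0 _ 1) /(res_eq0 HR) [l' e] : rs l ^+ 2 = 0.
  have h' := congr1 rs ht; rewrite !resE exprS in h'; apply: etrans (etrans (esym h') _); ring.
subst l.
have ht' : pi ^+ n * t = pi * l' ^+ 2 + 4 * v * k ^+ 2 - 4 * pi * mu ^+ 2 * k ^+ 4.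
  apply: (pi_inj HR); transitivity (pi ^+ n.+1 * t); first by rewrite mulrA -exprS.
  by rewrite ht; ring.
case: n ih hn hs ht ht' => [|n] ih hn hs ht ht'.
  apply: hn; exists (2 * rs v * rs k); have h' := congr1 rs ht'; rewrite !resE expr0 mul1r in h'.
  by rewrite h' /=; ring.
have /eqP : 4 * rs v * rs k ^+ 2 = 0.
  have h' := congr1 rs ht'; rewrite !resE exprS in h'; apply: etrans (etrans (esym h') _); ring.
rewrite !mulf_eq0 (negbTE (four_neq0 F2)) (negbTE v0) /= orbb => /eqP /(res_eq0 HR) [k' e]; subst k.
have ht'' : pi ^+ n * t = l' ^+ 2 + 4 * pi * v * k' ^+ 2 - 4 * (pi * (pi * mu)) ^+ 2 * k' ^+ 4.
  by apply: (pi_inj HR); transitivity (pi ^+ n.+1 * t); [rewrite mulrA -exprS|rewrite ht'; ring].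
case: n ih hn hs ht ht' ht'' => [|n] ih hn hs ht ht' ht''.
  apply: hn; exists (rs l'); have h' := congr1 rs ht''; rewrite !resE expr0 mul1r in h'.
  by rewrite h' /=; ring.
apply: (ih n _ (pi * mu) k' l') => //.
  by move: hn; rewrite /= !negbK.
do 2 apply: (pi_inj HR); transitivity (pi ^+ n.+3 * s); first by rewrite !exprS !mulrA.
by rewrite hs; ring.
Qed.

Lemma ramified_irreducible n v s t : rs v != 0 ->
  (rs s != 0 \/ exists s', s = pi * s' /\ ~ is_square (rs t * rs v ^+ odd n.+1)) ->
  ~ splits (pi * v) (pi ^+ n.+2 * s) (pi ^+ n.+3 * t).
Proof.
move=> v0 hst [[r h]|[k [l [hs ht]]]].
  have /(@sqr_eq0 _ 3) /(res_eq0 HR) [r' e] : rs r ^+ 4 = 0.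
    by have h' := congr1 rs h; rewrite !resE !exprS in h'; apply: etrans (etrans h' _); ring.
  subst r; have h2 : (pi * r' ^+ 2 - v) ^+ 2 = pi * (pi ^+ n * s * r' + pi ^+ n * t).
    apply: (pi_inj HR); apply: (pi_inj HR); apply: etrans (etrans h _); first by ring.
    by rewrite !exprS; ring.
  have /(@sqr_eq0 _ 1) v00 : rs v ^+ 2 = 0.
    by have h' := congr1 rs h2; rewrite !resE in h'; apply: etrans (etrans h' _); ring.
  by rewrite v00 eqxx in v0.
have e1 := congr1 rs hs; have e2 := congr1 rs ht; rewrite !resE !exprS in e1 e2.
have [|||k0 l0] := @res_both0 k l (4 * rs k ^+ 3).
- by rewrite -e1; ring.
- by apply/eqP; rewrite -subr_eq0; apply/eqP; apply: etrans (etrans (esym e2) _); ring.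
- by move=> _ /eqP; rewrite mulf_eq0 (negbTE (four_neq0 F2)) /= expf_eq0 /= => /eqP.
have [k' [l' [hk hl]]] := pi_dvd2 k0 l0; subst k l.
have hs' : pi ^+ n * s = 4 * k' * l'.
  apply: (pi_inj HR); apply: (pi_inj HR); transitivity (pi ^+ n.+2 * s); first by rewrite !exprS; ring.
  by rewrite hs; ring.
have ht' : pi ^+ n.+1 * t = l' ^+ 2 + 4 * pi * v * k' ^+ 2 - 4 * (pi * 1) ^+ 2 * k' ^+ 4.
  apply: (pi_inj HR); apply: (pi_inj HR); transitivity (pi ^+ n.+3 * t); first by rewrite !exprS; ring.
  by rewrite ht; ring.
case: hst => [s0|[s' [es hn]]]; first exact: ramified_not_splits_s v0 s0 hs' ht'.
apply: (ramified_not_splits_t (s := s')) v0 hn _ ht'.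
by rewrite -hs' es exprSr mulrA.
Qed.

(** The Newton polygon is one segment of slope 3/4, a fraction in lowest terms. *)
Lemma slope_irreducible v s t : rs t != 0 ->
  ~ splits (pi ^+ 2 * v) (pi ^+ 3 * s) (pi ^+ 3 * t).
Proof.
move/eqP=> ht0 [[r h]|[k [l [hs ht]]]]; apply: ht0.
  have /(@sqr_eq0 _ 3) /(res_eq0 HR) [r' e] : rs r ^+ 4 = 0.
    by have h' := congr1 rs h; rewrite !resE in h'; apply: etrans (etrans h' _); ring.
  subst r; have -> : t = pi * ((r' ^+ 2 - v) ^+ 2 - s * r').
    do 3 apply: (pi_inj HR); apply/(addrI (pi ^+ 3 * s * (pi * r'))).
    transitivity (pi ^+ 3 * s * (pi * r') + pi ^+ 3 * t); [ring|rewrite -h; ring].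
  by rewrite !resE !mul0r.
have e1 := congr1 rs hs; have e2 := congr1 rs ht; rewrite !resE in e1 e2.
have [|||k0 l0] := @res_both0 k l (4 * rs k ^+ 3).
- by rewrite -e1; ring.
- by apply/eqP; rewrite -subr_eq0; apply/eqP; apply: etrans (etrans (esym e2) _); ring.
- by move=> _ /eqP; rewrite mulf_eq0 (negbTE (four_neq0 F2)) /= expf_eq0 /= => /eqP.
have [k' [l' [hk hl]]] := pi_dvd2 k0 l0; subst k l.
have ht' : pi * t = l' ^+ 2 + 4 * pi ^+ 2 * v * k' ^+ 2 - 4 * pi ^+ 2 * k' ^+ 4.
  by do 2 apply: (pi_inj HR); transitivity (pi ^+ 3 * t); [ring|rewrite ht; ring].
have /(@sqr_eq0 _ 1) /(res_eq0 HR) [l1 e] : rs l' ^+ 2 = 0.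
  by have h' := congr1 rs ht'; rewrite !resE in h'; apply: etrans (etrans (esym h') _); ring.
subst l'; rewrite (_ : t = pi * (l1 ^+ 2 + 4 * v * k' ^+ 2 - 4 * k' ^+ 4)) ?resE ?mul0r //.
by apply: (pi_inj HR); rewrite ht'; ring.
Qed.

Lemma slope_splits v s t : rs s != 0 -> splits (pi ^+ 2 * v) (pi ^+ 2 * s) (pi ^+ 3 * t).
Proof.
move=> hs; have [w hw] := res_unit HR hs.
have [] := @hensel_root _ _ _ _ _ HR pi 1 v s t (lift (rs (w * (- t)))).
- rewrite !(res_lift HR, res_pi HR, rmorphD, rmorphM, rmorphN, rmorphXn, res_num, rmorph1) !(mul0r, mul1r) ?sub0r.
  have := congr1 rs hw; rewrite !resE => hw'.
  by rewrite mulrA hw'; ring.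
- by rewrite !resE !(mul0r, mulr0) sub0r oppr_eq0.
by move=> r h; left; exists (pi * r); transitivity (pi ^+ 3 * (pi * (1 * r ^+ 2 - v) ^+ 2)); [ring|rewrite h; ring].
Qed.

(** The weights 2, 3, 4 are those of [y -> pi y]. Conversely, [pi] divides any root of the scaled
    quartic, and in a factorization [pi] divides [k] and [pi^2] divides [l], so the scaling can be
    undone. *)
Lemma splits_scale v s t : splits (pi ^+ 2 * v) (pi ^+ 3 * s) (pi ^+ 4 * t) <-> splits v s t.
Proof.
split=> [[[r h]|[k [l [hs ht]]]]|[[r h]|[k [l [hs ht]]]]].
- have /(@sqr_eq0 _ 3) /(res_eq0 HR) [r' e] : rs r ^+ 4 = 0.
    by have h' := congr1 rs h; rewrite !resE in h'; apply: etrans (etrans h' _); ring.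
  subst r; left; exists r'; do 4 apply: (pi_inj HR).
  by apply: etrans (etrans h _); ring.
- have e1 := congr1 rs hs; have e2 := congr1 rs ht; rewrite !resE in e1 e2.
  have [|||k0 l0] := @res_both0 k l (4 * rs k ^+ 3).
  + by rewrite -e1; ring.
  + by apply/eqP; rewrite -subr_eq0; apply/eqP; apply: etrans (etrans (esym e2) _); ring.
  + by move=> _ /eqP; rewrite mulf_eq0 (negbTE (four_neq0 F2)) /= expf_eq0 /= => /eqP.
  have [k' [l' [hk hl]]] := pi_dvd2 k0 l0; subst k l.
  have ht' : pi ^+ 2 * t = l' ^+ 2 + 4 * pi ^+ 2 * v * k' ^+ 2 - 4 * pi ^+ 2 * k' ^+ 4.
    by do 2 apply: (pi_inj HR); transitivity (pi ^+ 4 * t); [ring|rewrite ht; ring].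
  have /(@sqr_eq0 _ 1) /(res_eq0 HR) [l1 e] : rs l' ^+ 2 = 0.
    by have h' := congr1 rs ht'; rewrite !resE in h'; apply: etrans (etrans (esym h') _); ring.
  subst l'; right; exists k', l1; split.
    by do 3 apply: (pi_inj HR); transitivity (pi ^+ 3 * s); [ring|rewrite hs; ring].
  by do 2 apply: (pi_inj HR); transitivity (pi ^+ 2 * t); [ring|rewrite ht'; ring].
- left; exists (pi * r); transitivity (pi ^+ 4 * (r ^+ 2 - v) ^+ 2); [ring|rewrite h; ring].
by right; exists (pi * k), (pi ^+ 2 * l); rewrite hs ht; split; ring.
Qed.

End Criteria.

(* At all large levels, [P] meets at most a proportion [m] of the boxes
   [(v + pi^N1) x (s + pi^N2) x (t + pi^N3)]. The three levels are independent
   so that one coordinate can be split according to its residue. *)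
Definition box_cover (R : numDomainType) (F : finFieldType) (A : comNzRingType) (pi : A)
    (P : A -> A -> A -> Prop) (m : R) : Prop :=
  exists N0, forall N1 N2 N3, (N0 <= N1)%N -> (N0 <= N2)%N -> (N0 <= N3)%N ->
  exists L : seq (A * A * A),
    (size L)%:R <= m * #|F|%:R ^+ (N1 + N2 + N3) /\
    forall v s t, P v s t -> exists2 x, x \in L &
      [/\ congruent pi N1 v x.1.1, congruent pi N2 s x.1.2 & congruent pi N3 t x.2].

(** The cover of the complement serves as a lower bound for [P]. Both bounds are affine in [m] and
    [d], so they average over residue classes. *)
Definition has_density (R : numDomainType) (F : finFieldType) (A : comNzRingType) (pi : A)
    (P : A -> A -> A -> Prop) (m d : R) : Prop :=
  box_cover F pi P (m + d) /\ box_cover F pi (fun v s t => ~ P v s t) (1 - m + d).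

(** * Calculus of box covers and of two-sided densities *)

Section Cover.
Variables (R : realFieldType) (A : comNzRingType) (F : finFieldType) (pi : A).
Variables (rs : {rmorphism A -> F}) (lift : F -> A).
Hypothesis HR : henselian pi rs lift.
Implicit Types (P Q : A -> A -> A -> Prop) (m d : R).
Local Notation box_cover := (box_cover F pi).
Local Notation has_density := (has_density F pi).
Local Notation q := (#|F|%:R : R).

Lemma card_gt0 : 0 < q.
Proof. by rewrite ltr0n; apply/card_gt0P; exists 0. Qed.

Lemma card_neq0 : q != 0.
Proof. by rewrite gt_eqF ?card_gt0. Qed.

Lemma cover_sub P Q m : (forall v s t, P v s t -> Q v s t) -> box_cover Q m -> box_cover P m.
Proof.
move=> PQ [N0 H]; exists N0 => N1 N2 N3 h1 h2 h3.
have [L [hL cL]] := H _ _ _ h1 h2 h3.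
by exists L; split=> // v s t /PQ; apply: cL.
Qed.

Lemma cover_le P m m' : m <= m' -> box_cover P m -> box_cover P m'.
Proof.
move=> hm [N0 H]; exists N0 => N1 N2 N3 h1 h2 h3.
have [L [hL cL]] := H _ _ _ h1 h2 h3.
exists L; split=> //; apply: (le_trans hL).
by rewrite ler_wpM2r // exprn_ge0 // ltW // card_gt0.
Qed.

Lemma cover_empty P m : 0 <= m -> (forall v s t, ~ P v s t) -> box_cover P m.
Proof.
move=> hm h; exists 0%N => N1 N2 N3 _ _ _; exists [::]; split=> [|v s t /h] //.
by rewrite mulr_ge0 // exprn_ge0 // ltW // card_gt0.
Qed.

Lemma residues n : exists L : seq A, size L = (#|F| ^ n)%N /\
  forall x, exists2 a, a \in L & congruent pi n x a.
Proof.
elim: n => [|n [L [sL cL]]].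
  exists [:: 0]; split=> // x; exists 0; rewrite ?inE //.
  by exists x; rewrite expr0; ring.
exists [seq lift r + pi * a | r <- enum F, a <- L]; split.
  by rewrite size_allpairs sL -cardE expnS.
move=> x; have [y hy] := res_split HR (erefl (rs x)).
have [a aL [z hz]] := cL y.
exists (lift (rs x) + pi * a); first by apply: allpairs_f; rewrite ?mem_enum.
by exists z; rewrite {1}hy hz exprS; ring.
Qed.

Lemma cover_full P m : 1 <= m -> box_cover P m.
Proof.
move=> hm; apply: (cover_le hm); exists 0%N => N1 N2 N3 _ _ _.
have [L1 [s1 c1]] := residues N1; have [L2 [s2 c2]] := residues N2.
have [L3 [s3 c3]] := residues N3.
exists [seq (x, c) | x <- [seq (a, b) | a <- L1, b <- L2], c <- L3]; split.
  by rewrite !size_allpairs s1 s2 s3 mul1r -!expnD natrX.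
move=> v s t _; have [a aL ca] := c1 v; have [b bL cb] := c2 s; have [c cL cc] := c3 t.
exists (a, b, c) => //.
by apply: (@allpairs_f _ _ _ (fun x c => (x, c))) => //; apply: (@allpairs_f _ _ _ (fun a b => (a, b))).
Qed.

Lemma cover_rot P m : box_cover P m -> box_cover (fun v s t => P t v s) m.
Proof.
case=> N0 H; exists N0 => N1 N2 N3 h1 h2 h3.
have [L [hL cL]] := H _ _ _ h3 h1 h2.
exists [seq (x.1.2, x.2, x.1.1) | x <- L]; split.
  by rewrite size_map (_ : N1 + N2 + N3 = N3 + N1 + N2)%N // addnC addnA.
move=> v s t /cL [x xL [c1 c2 c3]]; exists (x.1.2, x.2, x.1.1) => //.
by apply: (map_f (fun x : A * A * A => (x.1.2, x.2, x.1.1))).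
Qed.

Lemma cover_split P (m : F -> R) :
  (forall r, box_cover (fun v s t => P v s (lift r + pi * t)) (m r)) ->
  box_cover P (q^-1 * \sum_r m r).
Proof.
(* One level of [t] is spent on its residue, hence the successor. *)
move=> /choice [N0 H]; exists (\max_r N0 r).+1 => N1 N2 [//|N3] h1 h2 h3.
have /choice [L HL] : forall r, exists L : seq (A * A * A),
    (size L)%:R <= m r * q ^+ (N1 + N2 + N3) /\
    forall v s t, P v s (lift r + pi * t) -> exists2 x, x \in L &
      [/\ congruent pi N1 v x.1.1, congruent pi N2 s x.1.2 & congruent pi N3 t x.2].
  move=> r; have hr := leq_bigmax (F := N0) r.
  by apply: H; apply: (leq_trans hr) => //; apply: ltnW.
exists (flatten [seq [seq (x.1, lift r + pi * x.2) | x <- L r] | r <- enum F]); split.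
  rewrite size_flatten /shape -map_comp sumnE big_map big_enum /= natr_sum.
  apply: (@le_trans _ _ (\sum_r m r * q ^+ (N1 + N2 + N3))).
    by apply: ler_sum => r _; rewrite size_map; have [] := HL r.
  rewrite -mulr_suml addnS exprS mulrACA mulrA mulrAC mulVf ?card_neq0 //.
  by rewrite mul1r mulrC.
move=> v s t hP; have [t' ht'] := res_split HR (erefl (rs t)).
rewrite ht' in hP; have [_ /(_ _ _ _ hP) [x xL [c1 c2 [z c3]]]] := HL (rs t).
exists (x.1, lift (rs t) + pi * x.2).
  apply/flattenP; exists [seq (x.1, lift (rs t) + pi * x.2) | x <- L (rs t)].
    by apply: (map_f (fun r => [seq (x.1, lift r + pi * x.2) | x <- L r])); rewrite mem_enum.
  exact: (map_f (fun x => (x.1, lift (rs t) + pi * x.2))).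
by split=> //; exists z; rewrite {1}ht' c3 exprS /=; ring.
Qed.

Lemma near_iff P Q m d : (forall v s t, P v s t <-> Q v s t) -> has_density P m d -> has_density Q m d.
Proof.
by move=> PQ [h1 h2]; split; [apply: cover_sub h1|apply: cover_sub h2] => v s t;
  rewrite PQ.
Qed.

Lemma near_le P m d d' : d <= d' -> has_density P m d -> has_density P m d'.
Proof. by move=> hd [h1 h2]; split; [apply: cover_le h1|apply: cover_le h2]; rewrite lerD2l. Qed.

Lemma near_always P d : 0 <= d -> (forall v s t, P v s t) -> has_density P 1 d.
Proof.
move=> hd h; split; first by apply: cover_full; rewrite lerDl.
by apply: cover_empty => [|v s t]; [rewrite subrr add0r|apply; apply: h].
Qed.

Lemma near_never P d : 0 <= d -> (forall v s t, ~ P v s t) -> has_density P 0 d.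
Proof.
move=> hd h; split; first by apply: cover_empty => //; rewrite add0r.
by apply: cover_full; rewrite subr0 lerDl.
Qed.

Lemma near_rot P m d : has_density P m d -> has_density (fun v s t => P t v s) m d.
Proof. by case=> h1 h2; split; [apply: (cover_rot h1)|apply: (cover_rot h2)]. Qed.

Lemma near_split_t P (m d : F -> R) :
  (forall r, has_density (fun v s t => P v s (lift r + pi * t)) (m r) (d r)) ->
  has_density P (q^-1 * \sum_r m r) (q^-1 * \sum_r d r).
Proof.
move=> H; split.
  rewrite -mulrDr -big_split /=; apply: cover_split => r; by case: (H r).
have -> : 1 - q^-1 * \sum_r m r + q^-1 * \sum_r d r = q^-1 * \sum_r (1 - m r + d r).
  rewrite big_split sumrB sumr_const -[_ *+ _]mulr_natr mul1r /=.
  by field; rewrite card_neq0.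
by apply: cover_split => r; case: (H r).
Qed.

Lemma near_split_s P (m d : F -> R) :
  (forall r, has_density (fun v s t => P v (lift r + pi * s) t) (m r) (d r)) ->
  has_density P (q^-1 * \sum_r m r) (q^-1 * \sum_r d r).
Proof.
move=> H; apply: (@near_rot (fun v s t => P s t v)).
by apply: near_split_t => r; apply: near_rot; apply: near_rot; apply: H.
Qed.

Lemma near_split_v P (m d : F -> R) :
  (forall r, has_density (fun v s t => P (lift r + pi * v) s t) (m r) (d r)) ->
  has_density P (q^-1 * \sum_r m r) (q^-1 * \sum_r d r).
Proof.
move=> H; do 2 apply: near_rot.
by apply: near_split_t => r; apply: near_rot; apply: H.
Qed.

End Cover.

(** * Counting squares in finite fields *)

(** Burnside's count for a group of order two: the fibres of [f] on [D] are the orbits of [tau], and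
    adding the fixed points makes every orbit count twice. *)
Lemma card_imset_involution (T U : finType) (f : T -> U) (tau : T -> T) (D : {set T}) :
  (forall x, x \in D -> tau x \in D) -> (forall x, x \in D -> tau (tau x) = x) ->
  (forall x y, x \in D -> y \in D -> f x = f y <-> y = x \/ y = tau x) ->
  (2 * #|f @: D| = #|D| + #|[set x in D | tau x == x]|)%N.
Proof.
move=> tD tauK fE.
have -> : #|[set x in D | tau x == x]| = (\sum_(x in D) (tau x == x))%N.
  by rewrite -sum1dep_card big_mkcondr; apply: eq_bigr => x _; case: eqP.
rewrite -[X in _ = (X + _)%N]sum1_card -big_split (partition_big_imset f) /= mulnC -sum_nat_const.
apply: eq_bigr => z /imsetP [x xD ->].
have ftx : f (tau x) = f x by apply/esym/fE => //; [exact: tD|right].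
rewrite (bigD1 x) /=; last by rewrite xD eqxx.
case: (eqVneq (tau x) x) => [e|ne].
  rewrite big1 ?addn0 // => y /andP[/andP[yD /eqP fy] yx].
  by have [|] := (fE x y xD yD).1 (esym fy); rewrite ?e => yE; rewrite yE eqxx in yx.
rewrite (bigD1 (tau x)) /=; last by rewrite tD ?ftx ?eqxx.
rewrite tauK // eq_sym (negbTE ne) big1 // => y /andP[/andP[/andP[yD /eqP fy] yx] yt].
by have [|] := (fE x y xD yD).1 (esym fy) => yE; [rewrite yE eqxx in yx|rewrite yE eqxx in yt].
Qed.

Section FiniteField.
Variable F : finFieldType.
Hypothesis F2 : (2 : F) != 0.
Local Notation q := #|F|.

Lemma eqN_self (x : F) : (- x == x) = (x == 0).
Proof.
by rewrite -subr_eq0 -opprD oppr_eq0 -mulr2n -[_ *+ 2]mulr_natr mulf_eq0 (negbTE F2) orbF.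
Qed.

Lemma card_nonzero : #|[set x : F | x != 0]| = q.-1.
Proof. by rewrite cardsE cardC1. Qed.

Lemma card_gt0F : (0 < q)%N.
Proof. by apply/card_gt0P; exists 0. Qed.

Lemma card_nonzero_squares : (2 * #|[set x : F | (x != 0%R) && `[< is_square x >]]| + 1 = q)%N.
Proof.
have -> : [set x : F | (x != 0) && `[< is_square x >]] = (fun x => x ^+ 2) @: [set x : F | x != 0].
  apply/setP => x; rewrite inE; apply/andP/imsetP => [[x0 /asboolP[w xw]]|[w]].
    by exists w => //; rewrite inE; apply: contraNneq x0 => w0; rewrite xw w0 expr0n.
  by rewrite inE => w0 ->; rewrite expf_neq0 //; split=> //; apply/asboolP; exists w.
rewrite (card_imset_involution (tau := -%R)).
- rewrite card_nonzero (_ : [set x in _ | _] = finset.set0) ?cards0 ?addn0 ?addn1 ?prednK ?card_gt0F //.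
  by apply/setP => x; rewrite !inE eqN_self; case: (x == 0).
- by move=> x; rewrite !inE oppr_eq0.
- by move=> x _; rewrite opprK.
move=> x y _ _; split=> [/esym/eqP|[->|->]]; rewrite ?sqrrN //.
by rewrite eqf_sqr => /orP[]/eqP; [left|right].
Qed.

Lemma card_nonsquares : (2 * #|[set x : F | ~~ `[< is_square x >]]| + 1 = q)%N.
Proof.
have := card_nonzero_squares; have := card_nonzero.
rewrite -(cardsID [set x : F | `[< is_square x >]]).
rewrite (_ : _ :&: _ = [set x : F | (x != 0) && `[< is_square x >]]); last by apply/setP => x; rewrite !inE.
rewrite (_ : _ :\: _ = [set x : F | ~~ `[< is_square x >]]); last first.
  apply/setP => x; rewrite !inE; case: (eqVneq x 0) => [->|_]; last by rewrite andbT.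
  by rewrite andbF; apply/esym/negbF/asboolP; exists 0; rewrite expr0n.
have := card_gt0F; lia.
Qed.

(** The map [f] is the squaring of [l + 2 k sqrt v] in the field with [q^2] elements, two to one
    away from zero. *)
Lemma card_square_pairs (v : F) : ~ is_square v ->
  (2 * #|[set x : F * F | (x != (0%R, 0%R)) && `[< square_pair v x.1 x.2 >]]| + 1 = q ^ 2)%N.
Proof.
move=> hv; pose f (x : F * F) := (4 * x.1 * x.2, x.2 ^+ 2 + 4 * v * x.1 ^+ 2).
have norm0 (k l : F) : l ^+ 2 = 4 * v * k ^+ 2 -> k = 0 /\ l = 0.
  move=> e; case: (eqVneq k 0) => [k0|k0].
    by split=> //; apply: (@sqr_eq0 _ l 1); rewrite e k0; ring.
  case: hv; exists (l / (2 * k)); apply: (mulfI (four_neq0 F2)); apply: (mulIf (expf_neq0 2 k0)).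
  by rewrite -e; field; rewrite k0 F2.
have sumsq x : f x = (0, 0) -> x = (0, 0).
  case: x => k l [/(mul4_eq0 F2) [] -> e].
    by congr pair; apply: (@sqr_eq0 _ l 1); rewrite -[RHS]e; ring.
  congr pair; apply/eqP; apply/negPn/negP => k0; apply: hv; exists 0.
  have k4 : 4 * k ^+ 2 != 0 by rewrite mulf_neq0 ?four_neq0 // expf_neq0.
  by apply: (mulfI k4); rewrite expr0n mulr0 -[RHS]e; ring.
have -> : [set x : F * F | (x != (0, 0)) && `[< square_pair v x.1 x.2 >]] = f @: [set x : F * F | x != (0, 0)].
  apply/setP => -[s t]; rewrite inE /=; apply/andP/imsetP => [[st0 /asboolP[k [l [hs ht]]]]|[[k l]]].
    exists (k, l); last by rewrite hs ht.
    rewrite inE; apply: contraNneq st0 => -[k0 l0]; rewrite hs ht k0 l0.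
    by apply/eqP; congr pair; ring.
  rewrite inE => x0 e; split; last by case: e => -> ->; apply/asboolP; exists k, l.
  by rewrite e; apply: contraNneq x0 => /sumsq ->.
rewrite (card_imset_involution (tau := fun x => (- x.1, - x.2))).
- rewrite (_ : [set x in _ | _] = finset.set0) ?cards0 ?addn0.
    rewrite cardsE cardC1 card_prod -mulnn; have := card_gt0F.
    by move=> h; rewrite addn1 prednK // muln_gt0 h.
  apply/setP => -[k l]; rewrite !inE /=; apply/negP => /andP[h /eqP[/eqP]].
  rewrite eqN_self => /eqP k0 /eqP; rewrite eqN_self => /eqP l0.
  by rewrite k0 l0 eqxx in h.
- move=> [k l]; rewrite !inE /=; apply: contraNneq => -[/eqP]; rewrite oppr_eq0 => /eqP -> /eqP.
  by rewrite oppr_eq0 => /eqP ->.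
- by move=> [k l] _ /=; rewrite !opprK.
move=> [k l] [k' l'] _ _; rewrite /f /=; split=> [[e1 e2]|[[-> ->]|[-> ->]]] //; last first.
  by congr pair; ring.
(* With [a = l + 2 k sqrt v], [a^2 = a'^2] reads [(a - a')(a + a') = 0]. *)
have h1 : (l - l') * (k + k') + (k - k') * (l + l') = 0.
  have /eqP : 2 * ((l - l') * (k + k') + (k - k') * (l + l')) = 0.
    by rewrite (_ : 2 * _ = 4 * k * l - 4 * k' * l'); [rewrite e1 subrr|ring].
  by rewrite mulf_eq0 (negbTE F2) => /eqP.
have h2 : (l - l') * (l + l') + 4 * v * (k - k') * (k + k') = 0.
  by rewrite (_ : _ + _ = (l ^+ 2 + 4 * v * k ^+ 2) - (l' ^+ 2 + 4 * v * k' ^+ 2)); [rewrite e2 subrr|ring].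
(* Eliminating [l + l'] leaves two cases: [k + k' = 0], or the norm of [a - a'] vanishes, and then
   [a = a']. *)
have [/eqP e|/eqP e] : (k + k' == 0) \/ ((l - l') ^+ 2 - 4 * v * (k - k') ^+ 2 == 0).
  apply/orP; rewrite -mulf_eq0; apply/eqP.
  transitivity ((l - l') * ((l - l') * (k + k') + (k - k') * (l + l'))
     - (k - k') * ((l - l') * (l + l') + 4 * v * (k - k') * (k + k'))); first by ring.
  by rewrite h1 h2 !mulr0 subrr.
  have k'E : k' = - k by apply/eqP; rewrite -addr_eq0 addrC e.
  have /eqP : 4 * k * (l + l') = 0.
    by rewrite -[RHS](mulr0 2) -h1 k'E; ring.
  rewrite !mulf_eq0 (negbTE (four_neq0 F2)) /= => /orP[/eqP k0|].
    move: h2; rewrite k'E k0 => h2; have /eqP : (l - l') * (l + l') = 0 by rewrite -[RHS]h2; ring.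
    rewrite mulf_eq0 => /orP[]; rewrite ?subr_eq0 ?addr_eq0 => /eqP ->; [left|right].
      by congr pair; ring.
    by congr pair; ring.
  by rewrite addr_eq0 => /eqP ->; right; rewrite k'E opprK.
have /eqP : (l - l') ^+ 2 = 4 * v * (k - k') ^+ 2 by apply/eqP; rewrite -subr_eq0 e.
by move/eqP/norm0 => [/eqP + /eqP]; rewrite !subr_eq0 => /eqP -> /eqP ->; left.
Qed.

End FiniteField.

(** * Counting irreducible depressed quartics over a finite field *)

Section IrreducibleCount.
Variable F : finFieldType.
Hypothesis F2 : (2 : F) != 0.
Local Notation q := #|F|.

Definition has_root (f : F * F * F) (y : F) : bool :=
  (y ^+ 2 - f.1.1) ^+ 2 == f.1.2 * y + f.2.

(** This and the next three lemmas are successive divided differences of the quartic: one root fixes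
    [t], two distinct roots fix [s], three fix [v], and a fourth must make the sum zero because
    there is no cubic term. *)
Lemma has_root1 v s t y : has_root (v, s, t) y = (t == (y ^+ 2 - v) ^+ 2 - s * y).
Proof.
rewrite /has_root /= -subr_eq0 -[RHS]subr_eq0 -[RHS]oppr_eq0; congr (_ == 0); ring.
Qed.

Lemma has_root2 v s t y1 y2 : y1 != y2 -> has_root (v, s, t) y1 ->
  has_root (v, s, t) y2 = (s == (y1 + y2) * (y1 ^+ 2 + y2 ^+ 2 - 2 * v)).
Proof.
move=> y12; rewrite !has_root1 => /eqP ->.
rewrite -subr_eq0 -[RHS]subr_eq0 (_ : _ - _ = (y2 - y1) * (s - (y1 + y2) * (y1 ^+ 2 + y2 ^+ 2 - 2 * v))); last by ring.
have y21 : y2 - y1 != 0 by rewrite subr_eq0 eq_sym.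
by rewrite mulf_eq0 (negbTE y21).
Qed.

Lemma has_root3 v s t y1 y2 y3 : y1 != y2 -> y1 != y3 -> y2 != y3 ->
  has_root (v, s, t) y1 -> has_root (v, s, t) y2 ->
  has_root (v, s, t) y3 =
    (v == (y1 ^+ 2 + y2 ^+ 2 + y3 ^+ 2 + y1 * y2 + y1 * y3 + y2 * y3) / 2).
Proof.
move=> y12 y13 y23 h1; rewrite (has_root2 y12 h1) (has_root2 y13 h1) => /eqP ->.
rewrite -subr_eq0 -[RHS]subr_eq0 (_ : _ - _ = (y3 - y2) * 2 * (v - (y1 ^+ 2 + y2 ^+ 2 + y3 ^+ 2 + y1 * y2 + y1 * y3 + y2 * y3) / 2)).
  have y32 : y3 - y2 != 0 by rewrite subr_eq0 eq_sym.
  by rewrite !mulf_eq0 (negbTE y32) (negbTE F2).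
by field.
Qed.

Lemma has_root4 v s t y1 y2 y3 y4 : uniq [:: y1; y2; y3; y4] ->
  has_root (v, s, t) y1 -> has_root (v, s, t) y2 -> has_root (v, s, t) y3 ->
  has_root (v, s, t) y4 = (y1 + y2 + y3 + y4 == 0).
Proof.
rewrite /= !inE !negb_or => /and4P[/and3P[y12 y13 y14] /andP[y23 y24] y34 _] h1 h2.
rewrite (has_root3 y12 y13 y23 h1 h2) (has_root3 y12 y14 y24 h1 h2) => /eqP ->.
rewrite -subr_eq0 (_ : _ - _ = (y3 - y4) / 2 * (y1 + y2 + y3 + y4)); last by field.
have {}y34 : y3 - y4 != 0 by rewrite subr_eq0.
by rewrite !mulf_eq0 (negbTE y34) invr_eq0 (negbTE F2).
Qed.

Lemma card_roots_le4 f : (#|has_root f| <= 4)%N.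
Proof.
pose p : {poly F} := ('X ^+ 2 - f.1.1%:P) ^+ 2 - f.1.2 *: 'X - f.2%:P.
have sp : size p = 5%N.
  have s1 : size ('X ^+ 2 - f.1.1%:P) = 3%N.
    by rewrite size_polyDl ?size_polyXn // size_polyN size_polyC; case: (_ != _).
  have s2 : size (('X ^+ 2 - f.1.1%:P) ^+ 2) = 5%N.
    by rewrite expr2 size_mul -?size_poly_eq0 ?s1.
  rewrite /p -addrA size_polyDl // s2 (leq_ltn_trans (size_polyD _ _)) // gtn_max !size_polyN.
  rewrite (leq_ltn_trans (size_scale_leq _ _)) ?size_polyX // size_polyC.
  by case: (_ != _).
have p0 : p != 0 by rewrite -size_poly_eq0 sp.
rewrite cardE -ltnS -sp; apply: max_poly_roots => //; last exact: enum_uniq.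
apply/allP => y; rewrite mem_enum unfold_in => /eqP h.
by rewrite /root /p !(hornerE, horner_exp) h; apply/eqP; ring.
Qed.

(** Double counting: [n ^_ j] is the number of [j]-tuples of distinct roots when there are [n]
    roots. *)
Lemma sum_ffact_roots j :
  (\sum_f #|has_root f| ^_ j = \sum_(x : j.-tuple F | uniq x) #|[set f | all (has_root f) x]|)%N.
Proof.
under eq_bigr => f _ do rewrite -card_uniq_tuples -sum1dep_card.
rewrite (exchange_big_dep (fun x : j.-tuple F => uniq x)) /=; last by move=> f x _ /andP[].
apply: eq_bigr => x ux; rewrite -sum1dep_card.
by apply: eq_bigl => f; rewrite ux andbT.
Qed.

Lemma card_uniq_tuple_all j : (\sum_(x : j.-tuple F | uniq x) 1 = q ^_ j)%N.
Proof.
rewrite sum1dep_card -(card_uniq_tuples j (fun _ : F => true)).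
by apply: eq_card => x; rewrite !inE all_predT.
Qed.

Lemma sum_roots1 : (\sum_f #|has_root f| ^_ 1 = q ^ 2 * q)%N.
Proof.
rewrite sum_ffact_roots -[X in (_ * X)%N]ffactn1 -card_uniq_tuple_all big_distrr /=.
apply: eq_bigr => x _; case/tupleP: x => y x; rewrite tuple0 muln1.
rewrite (_ : [set f | _] = (fun a : F * F => (a.1, a.2, (y ^+ 2 - a.1) ^+ 2 - a.2 * y)) @: finset.setT).
  by rewrite card_imset ?cardsT ?card_prod ?mulnn // => -[v s] [v' s'] [-> ->].
apply/setP => -[[v s] t]; rewrite inE /= andbT has_root1; apply/eqP/imsetP => [->|[[v' s'] _ [-> -> ->]]] //.
by exists (v, s).
Qed.

Lemma sum_roots2 : (\sum_f #|has_root f| ^_ 2 = q * q ^_ 2)%N.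
Proof.
rewrite sum_ffact_roots -card_uniq_tuple_all big_distrr /=.
apply: eq_bigr => x; case/tupleP: x => y1 x; case/tupleP: x => y2 x; rewrite tuple0 muln1 /= inE andbT => y12.
pose s0 v := (y1 + y2) * (y1 ^+ 2 + y2 ^+ 2 - 2 * v).
rewrite (_ : [set f | _] = (fun v : F => (v, s0 v, (y1 ^+ 2 - v) ^+ 2 - s0 v * y1)) @: finset.setT).
  by rewrite card_imset ?cardsT // => v v' [].
apply/setP => -[[v s] t]; rewrite inE /= andbT; apply/andP/imsetP => [[h1]|[v' _ [-> -> ->]]].
  rewrite (has_root2 y12 h1) => /eqP es; exists v => //.
  by rewrite /s0 -es; move: h1; rewrite has_root1 => /eqP ->.
have h1 : has_root (v', s0 v', (y1 ^+ 2 - v') ^+ 2 - s0 v' * y1) y1 by rewrite has_root1.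
by rewrite (has_root2 y12 h1) h1.
Qed.

Lemma three_roots y1 y2 y3 : uniq [:: y1; y2; y3] ->
  exists f, [set f | [&& has_root f y1, has_root f y2 & has_root f y3]] = [set f].
Proof.
rewrite /= !inE negb_or => /and3P[/andP[y12 y13] y23 _].
pose v0 := (y1 ^+ 2 + y2 ^+ 2 + y3 ^+ 2 + y1 * y2 + y1 * y3 + y2 * y3) / 2.
pose s0 := (y1 + y2) * (y1 ^+ 2 + y2 ^+ 2 - 2 * v0).
pose t0 := (y1 ^+ 2 - v0) ^+ 2 - s0 * y1.
exists (v0, s0, t0); apply/setP => -[[v s] t]; rewrite !inE.
apply/and3P/eqP => [[h1 h2]|[-> -> ->]].
  rewrite (has_root3 y12 y13 y23 h1 h2) => /eqP ev; move: h2.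
  rewrite (has_root2 y12 h1) => /eqP es; move: h1; rewrite has_root1 => /eqP ->.
  by rewrite es ev.
have h1 : has_root (v0, s0, t0) y1 by rewrite has_root1.
have h2 : has_root (v0, s0, t0) y2 by rewrite (has_root2 y12 h1).
by split=> //; rewrite (has_root3 y12 y13 y23 h1 h2).
Qed.

Lemma sum_roots3 : (\sum_f #|has_root f| ^_ 3 = q ^_ 3)%N.
Proof.
rewrite sum_ffact_roots -card_uniq_tuple_all.
apply: eq_bigr => x; case/tupleP: x => y1 x; case/tupleP: x => y2 x; case/tupleP: x => y3 x; rewrite tuple0 => ux.
have [f hf] := three_roots ux.
by rewrite -[RHS](cards1 f) -hf; apply: eq_card => g; rewrite !inE /= andbT.
Qed.

Lemma sum_roots4 :
  (\sum_f #|has_root f| ^_ 4 = \sum_(x : 4.-tuple F | uniq x) (\sum_(i < 4) tnth x i == 0)%R)%N.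
Proof.
rewrite sum_ffact_roots; apply: eq_bigr => x.
case/tupleP: x => y1 x; case/tupleP: x => y2 x; case/tupleP: x => y3 x; case/tupleP: x => y4 x.
rewrite tuple0 => ux; rewrite !big_ord_recl big_ord0 !(tnth_nth 0) /= addr0 !addrA.
have u3 : uniq [:: y1; y2; y3].
  by move: ux; rewrite /= !inE !negb_or => /and4P[/and3P[-> -> _] /andP[-> _] _ _].
have [[[v s] t] hf] := three_roots u3.
have hg g : all (has_root g) [:: y1; y2; y3; y4] = (g == (v, s, t)) && (y1 + y2 + y3 + y4 == 0).
  have := congr1 (fun S : {set F * F * F} => g \in S) hf; rewrite !inE => <-.
  rewrite /= andbT -!andbA; case: g => [[v' s'] t'].
  case h1 : has_root => //=; case h2 : has_root => //=; case h3 : has_root => //=.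
  exact: has_root4 ux h1 h2 h3.
case: eqP => h0.
  by rewrite -[RHS](cards1 (v, s, t)); apply: eq_card => g; move: (hg g); rewrite !inE /= => ->; rewrite h0 eqxx andbT.
by apply/eqP; rewrite cards_eq0; apply/eqP/setP => g; move: (hg g); rewrite !inE /= => ->; move/eqP: h0 => /negbTE ->; rewrite andbF.
Qed.

(* Translating a quadruple of sum [c] by [- c / 4] gives one of sum [0]. *)
Lemma card_quadruples_sum0 :
  (q * \sum_(x : 4.-tuple F | uniq x) (\sum_(i < 4) tnth x i == 0)%R = q ^_ 4)%N.
Proof.
rewrite -card_uniq_tuple_all [RHS](partition_big (fun x : 4.-tuple F => \sum_(i < 4) tnth x i) predT) //=.
rewrite -sum_nat_const; apply: eq_bigr => c _.
pose sh (a : F) (x : 4.-tuple F) := [tuple of map (fun y => y + a) x].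
have shK a : cancel (sh a) (sh (- a)).
  by move=> x; apply: val_inj; rewrite /= -map_comp map_id_in // => y _ /=; rewrite addrK.
have sum_sh a x : \sum_(i < 4) tnth (sh a x) i = \sum_(i < 4) tnth x i + 4 * a.
  under eq_bigr => i _ do rewrite tnth_map.
  by rewrite big_split sumr_const card_ord -[_ *+ 4]mulr_natl.
have uniq_sh a x : uniq (sh a x) = uniq x by rewrite map_inj_uniq //; apply: addIr.
rewrite [RHS](reindex_onto (sh (c / 4)) (sh (- (c / 4)))) => [|x _]; last first.
  by have := shK (- (c / 4)) x; rewrite opprK.
rewrite -big_mkcondr /=; apply: eq_bigl => x.
rewrite uniq_sh sum_sh shK eqxx andbT; congr (_ && _).
rewrite mulrCA mulfV ?four_neq0 // mulr1 -[RHS](inj_eq (addIr (- c))) addrK subrr.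
by [].
Qed.

(** Inclusion-exclusion: for [n <= 4] the alternating sum of the binomial coefficients of [n]
    detects [n = 0]. It is multiplied by 24, and its negative terms are moved to the left to stay in
    the natural numbers. *)
Lemma card_rootless :
  (24 * #|[set f | #|has_root f| == 0%N]| + 24 * q ^ 3 + 4 * q ^_ 3 =
   24 * q ^ 3 + 12 * (q * q ^_ 2) + \sum_f #|has_root f| ^_ 4)%N.
Proof.
have id n : (n <= 4)%N -> (24 * (n == 0) + 24 * n ^_ 1 + 4 * n ^_ 3 = 24 * 1 + 12 * n ^_ 2 + n ^_ 4)%N.
  by move: n => [|[|[|[|[|n]]]]].
have : (\sum_(f : F * F * F) (24 * (#|has_root f| == 0) + 24 * #|has_root f| ^_ 1 + 4 * #|has_root f| ^_ 3) =
   \sum_(f : F * F * F) (24 * 1 + 12 * #|has_root f| ^_ 2 + #|has_root f| ^_ 4))%N.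
  by apply: eq_bigr => f _; apply: id; apply: card_roots_le4.
rewrite big_split /= [X in (X + _)%N = _]big_split /= [RHS]big_split /= [X in _ = (X + _)%N]big_split /=.
rewrite -!big_distrr /= sum_roots1 sum_roots2 sum_roots3 sum1_card !card_prod.
rewrite -big_mkcond sum1dep_card -expnSr => ->.
by [].
Qed.

Lemma card_four_distinct_sum0 : (q * \sum_f #|has_root f| ^_ 4 = q ^_ 4)%N.
Proof. by rewrite sum_roots4 card_quadruples_sum0. Qed.

(* The product of [(y + k)^2 - a] and [(y - k)^2 - b]. *)
Definition pair_quartic (x : F * F * F) : F * F * F :=
  let: (k, a, b) := x in let: v := k ^+ 2 + (a + b) / 2 in let: l := (b - a) / 2 in
  (v, 4 * k * l, l ^+ 2 + 4 * v * k ^+ 2 - 4 * k ^+ 4).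

Lemma has_root_pair k a b y :
  has_root (pair_quartic (k, a, b)) y = ((y + k) ^+ 2 == a) || ((y - k) ^+ 2 == b).
Proof.
rewrite -[X in X || _]subr_eq0 -[X in _ || X]subr_eq0 -mulf_eq0 /has_root -subr_eq0 /=.
by congr (_ == 0); field.
Qed.

Lemma pair_quarticP v s t k l : s = 4 * k * l -> t = l ^+ 2 + 4 * v * k ^+ 2 - 4 * k ^+ 4 ->
  (v, s, t) = pair_quartic (k, v - k ^+ 2 - l, v - k ^+ 2 + l).
Proof.
move=> -> ->; rewrite /pair_quartic.
have -> : k ^+ 2 + (v - k ^+ 2 - l + (v - k ^+ 2 + l)) / 2 = v by field.
by have -> : (v - k ^+ 2 + l - (v - k ^+ 2 - l)) / 2 = l by field.
Qed.

Lemma rootless_pair k a b :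
  (#|has_root (pair_quartic (k, a, b))| == 0%N) = ~~ `[< is_square a >] && ~~ `[< is_square b >].
Proof.
apply/idP/andP => [/eqP/card0_eq h|[/asboolPn ha /asboolPn hb]].
  split; apply/asboolPn => -[w e].
    have : has_root (pair_quartic (k, a, b)) (w - k) = false := h (w - k).
    by rewrite has_root_pair subrK e eqxx.
  have : has_root (pair_quartic (k, a, b)) (w + k) = false := h (w + k).
  by rewrite has_root_pair addrK e eqxx orbT.
apply/eqP/eq_card0 => y; rewrite -[LHS]/(has_root _ _) [RHS]inE has_root_pair; apply/negP => /orP[]/eqP e.
  by apply: ha; exists (y + k).
by apply: hb; exists (y - k).
Qed.

(* [k^2] is a root of the cubic resolvent [16 z (t - 4 v z + 4 z^2) - s^2]; a second
   nonzero root [k'^2] would make one of the four discriminants a square. *)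
Lemma pair_quartic_inj k a b k' a' b' :
  ~ is_square a -> ~ is_square b -> ~ is_square a' -> ~ is_square b' ->
  pair_quartic (k, a, b) = pair_quartic (k', a', b') <->
  (k', a', b') = (k, a, b) \/ (k', a', b') = (- k, b, a).
Proof.
move=> ha hb ha' hb'; split; last first.
  case=> -[-> -> ->] //; rewrite /pair_quartic sqrrN [b + a]addrC.
  by congr (_, _, _); field.
rewrite /pair_quartic; set v := k ^+ 2 + _; set l := (b - a) / 2.
set v' := k' ^+ 2 + _; set l' := (b' - a') / 2 => -[ev es et].
have ea : a = v - k ^+ 2 - l by rewrite /v /l; field.
have eb : b = v - k ^+ 2 + l by rewrite /v /l; field.
have ea' : a' = v - k' ^+ 2 - l' by rewrite ev /v' /l'; field.
have eb' : b' = v - k' ^+ 2 + l' by rewrite ev /v' /l'; field.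
rewrite -ev in et; move: v l v' l' ev es et ea eb ea' eb' => v l v' l' _ es et ea eb ea' eb'.
have {}es : k * l = k' * l' by apply: (mulfI (four_neq0 F2)); rewrite !mulrA.
case: (eqVneq (k ^+ 2) (k' ^+ 2)) => [ek|nk].
  have el : l ^+ 2 = l' ^+ 2.
    apply: (addIr (4 * v * k ^+ 2 - 4 * (k ^+ 2) ^+ 2)); rewrite [in RHS]ek.
    by apply: etrans (etrans et _); ring.
  rewrite ea eb ea' eb' -ek.
  move/eqP: ek; rewrite eqf_sqr => /orP[]/eqP ek.
    subst k'; case: (eqVneq k 0) => [k0|k0]; last by rewrite (mulfI k0 es); left.
    move/eqP: el; rewrite eqf_sqr => /orP[]/eqP ->; first by left.
    by right; rewrite k0 oppr0 !opprK.
  have {}ek : k' = - k by rewrite ek opprK.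
  subst k'; case: (eqVneq k 0) => [k0|k0].
    move/eqP: el; rewrite eqf_sqr => /orP[]/eqP ->; first by left; rewrite k0 oppr0.
    by right; rewrite !opprK.
  right; have -> : l' = - l by apply: (mulfI k0); rewrite mulrN es mulNr opprK.
  by rewrite opprK.
exfalso.
(* These are the three roots of the resolvent: their sum is [v], and Vieta's product formula
   explains [el] and [el']. *)
pose z := k ^+ 2; pose z' := k' ^+ 2; pose z2 := v - z - z'.
have zz' : z - z' != 0 by rewrite subr_eq0.
have el : l ^+ 2 = 4 * z' * z2.
  apply: (mulfI zz').
  have h : z * l ^+ 2 = z' * (l ^+ 2 + 4 * v * z - 4 * z ^+ 2 - 4 * v * z' + 4 * z' ^+ 2).
    have -> : l ^+ 2 + 4 * v * z - 4 * z ^+ 2 - 4 * v * z' + 4 * z' ^+ 2 = l' ^+ 2.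
      apply: (addIr (4 * v * z' - 4 * z' ^+ 2)).
      by apply: etrans (etrans et _); rewrite /z /z'; ring.
    by rewrite /z /z' -!exprMn es.
  by rewrite mulrBl h /z2; ring.
have el' : l' ^+ 2 = 4 * z * z2.
  apply: (addIr (4 * v * z' - 4 * z' ^+ 2)); rewrite -[RHS]addr0.
  transitivity (l ^+ 2 + 4 * v * z - 4 * z ^+ 2); last by rewrite el /z2; ring.
  by apply: etrans (etrans (esym et) _); rewrite /z /z'; ring.
(* Since [z2 = (l / (2 k'))^2], the discriminant [a = z' + z2 - l] is a perfect square; if [k' = 0],
   the two factorizations exchange roles. *)
case: (eqVneq k' 0) => [k'0|k'0].
  have k0 : k != 0 by apply: contraNneq nk => ->; rewrite k'0.
  apply: ha'; exists (k - l' / (2 * k)); rewrite ea'.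
  have -> : (k - l' / (2 * k)) ^+ 2 = z + z2 - l'.
    have -> : z2 = l' ^+ 2 / (4 * z).
      by rewrite el' mulrAC mulfV ?mul1r // mulf_neq0 ?four_neq0 ?expf_neq0.
    by rewrite /z; field; rewrite ?k0 ?F2 ?(four_neq0 F2).
  by rewrite /z2 /z'; ring.
apply: ha; exists (k' - l / (2 * k')); rewrite ea.
have -> : (k' - l / (2 * k')) ^+ 2 = z' + z2 - l.
  have -> : z2 = l ^+ 2 / (4 * z').
    by rewrite el mulrAC mulfV ?mul1r // mulf_neq0 ?four_neq0 ?expf_neq0.
  by rewrite /z'; field; rewrite ?k'0 ?F2 ?(four_neq0 F2).
by rewrite /z2 /z; ring.
Qed.

(** Without a root, both [(y + k)^2 - a] and [(y - k)^2 - b] are irreducible. Exchanging them is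
    [(k, a, b) -> (- k, b, a)], which fixes a triple exactly when [k = 0] and [a = b]. *)
Lemma card_pairs_rootless :
  (8 * #|[set f | (#|has_root f| == 0%N) && `[< splits f.1.1 f.1.2 f.2 >]]| + 2 * q ^ 2 + 2 =
   q ^ 3 + 3 * q)%N.
Proof.
pose NS := [set x : F | ~~ `[< is_square x >]].
pose D := [set x : F * F * F | (x.1.2 \in NS) && (x.2 \in NS)].
have -> : [set f | (#|has_root f| == 0%N) && `[< splits f.1.1 f.1.2 f.2 >]] = pair_quartic @: D.
  apply/setP => -[[v s] t]; rewrite inE /=; apply/andP/imsetP => [[/eqP h0 /asboolP[[r h]|[k [l [hs ht]]]]]|].
  - by have := card0_eq h0 r; rewrite inE -[LHS]/(has_root _ _) /has_root /= h eqxx.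
  - have e := pair_quarticP hs ht; exists (k, v - k ^+ 2 - l, v - k ^+ 2 + l) => //.
    by rewrite !inE /=; rewrite e in h0; rewrite -(rootless_pair k) h0.
  case=> -[[k a] b]; rewrite !inE /= => hab e; rewrite e rootless_pair hab; split=> //.
  by right; case: e => -> -> ->; exists k, ((b - a) / 2).
have hD : #|D| = (q * (#|NS| * #|NS|))%N.
  rewrite -[q]cardsT -!cardsX.
  rewrite -(card_imset (finset.setX _ _) (f := fun x : F * (F * F) => (x.1, x.2.1, x.2.2))); last first.
    by move=> [k [a b]] [k' [a' b']] /= [-> -> ->].
  apply: eq_card => -[[k a] b]; apply/idP/imsetP => [|[[k' [a' b']]]]; rewrite !inE /=.
    by move=> h; exists (k, (a, b)); rewrite ?inE.
  by move=> h [_ -> ->].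
have : (2 * #|pair_quartic @: D| = #|D| + #|[set x in D | ((- x.1.1)%R, x.2, x.1.2) == x]|)%N.
  apply: card_imset_involution.
  - by move=> [[k a] b]; rewrite !inE /= andbC.
  - by move=> [[k a] b] _ /=; rewrite opprK.
  move=> [[k a] b] [[k' a'] b']; rewrite !inE /= => /andP[/asboolPn ha /asboolPn hb] /andP[/asboolPn ha' /asboolPn hb'].
    exact: pair_quartic_inj.
have -> : #|[set x in D | (- x.1.1, x.2, x.1.2) == x]| = #|NS|.
  rewrite -(card_imset NS (f := fun a => (0, a, a) : F * F * F)); last by move=> a b [].
  apply: eq_card => -[[k a] b]; apply/idP/imsetP => [|[a' ]]; rewrite !inE /=.
    move=> /andP[/andP[ha hb]] /eqP[/eqP]; rewrite (eqN_self F2) => /eqP -> e _.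
    by exists a; rewrite ?inE // e.
  by move=> ha' [-> -> ->]; rewrite ha' oppr0 eqxx.
rewrite hD; have := card_nonsquares F2; rewrite -/NS => <-.
by move: #|NS| #|_| => h n; nia.
Qed.

(** This is the classical number [(q^4 - q^2) / 4] of irreducible monic quartics divided by [q], as
    each translation class has one depressed member. *)
Lemma card_irreducible :
  (4 * #|[set f : F * F * F | ~~ `[< splits f.1.1 f.1.2 f.2 >]]| + q = q ^ 3)%N.
Proof.
set I := [set f | _]; set J := [set f : F * F * F | (#|has_root f| == 0%N) && `[< splits f.1.1 f.1.2 f.2 >]].
have hIJ : #|[set f | #|has_root f| == 0%N]| = (#|I| + #|J|)%N.
  rewrite -(cardsID I); congr (_ + _)%N; apply: eq_card => f; rewrite !inE.
    rewrite andbC; case: asboolP => //= h; apply/eqP/eq_card0 => y.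
    rewrite [RHS]inE -[LHS]/(has_root _ _); apply/negP => /eqP e.
    by apply: h; left; exists y.
  by rewrite negbK andbC.
have := card_rootless; have := card_pairs_rootless; rewrite -/J hIJ.
have := card_four_distinct_sum0; have := card_nonzero_squares F2.
set S4 := (\sum_f _)%N; move: S4 #|J| #|I| #|[set x | _]| => S4 j i h hq.
have q0 := card_gt0F F; rewrite !ffactnS !ffactn0 !muln1.
case: h hq => [|h] hq; first last.
  have -> : (q = 2 * h + 3)%N by lia.
  rewrite (_ : (2 * h + 3).-1 = 2 * h + 2)%N; last by lia.
  rewrite (_ : (2 * h + 2).-1 = 2 * h + 1)%N; last by lia.
  rewrite (_ : (2 * h + 1).-1 = 2 * h)%N; last by lia.
  move=> e4; have {e4} : (S4 = (2 * h + 2) * ((2 * h + 1) * (2 * h)))%N.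
    by apply/eqP; rewrite -(eqn_pmul2l (m := 2 * h + 3)) ?e4 //; lia.
  by move=> -> e1 e2; nia.
have /card_le1_eqP h1 : (q <= 1)%N by lia.
have /eqP : (1 : F) = 0 by apply: h1.
by rewrite oner_eq0.
Qed.

End IrreducibleCount.

(** * Densities of irreducibles in the branches, and the affine equation *)

Section Density.
Variables (R : realType) (A : comNzRingType) (F : finFieldType) (pi : A).
Variables (rs : {rmorphism A -> F}) (lift : F -> A).
Hypothesis HR : henselian pi rs lift.
Hypothesis F2 : (2 : F) != 0.
Implicit Types (P Q : A -> A -> A -> Prop) (m d : R).
Local Notation has_density := (has_density F pi).
Local Notation q := (#|F|%:R : R).
Local Notation irr v s t := (~ splits v s t).

Lemma near_eq P Q m d : (forall v s t, P v s t = Q v s t) -> has_density P m d -> has_density Q m d.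
Proof. by move=> PQ; apply: near_iff => v s t; rewrite PQ. Qed.

Lemma near_crude P m : has_density P m (1 + `|m|).
Proof.
have := ler_norm m; have := ler_norm (- m); rewrite normrN => h1 h2.
by split; apply: (cover_full HR); lra.
Qed.

(* A contraction of the error, started from the crude estimate, makes it arbitrarily small. *)
Lemma near_limit (I : Type) (P : I -> A -> A -> A -> Prop) (m : I -> R) c :
  (forall i, `|m i| <= c) ->
  (forall d, 0 < d -> (forall i, has_density (P i) (m i) d) ->
     forall i, has_density (P i) (m i) (d / 2)) ->
  forall d, 0 < d -> forall i, has_density (P i) (m i) d.
Proof.
move=> hc step d d0.
have c0 : 0 < 1 + `|c| by rewrite ltr_pwDl.
have h n : forall i, has_density (P i) (m i) ((1 + `|c|) / 2 ^+ n).
  elim: n => [|n ih] i.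
    rewrite expr0 divr1; apply: near_le _ (near_crude _ _).
    by rewrite lerD2l (le_trans (hc i)) // ler_norm.
  have -> : (1 + `|c|) / 2 ^+ n.+1 = (1 + `|c|) / 2 ^+ n / 2 by rewrite exprSr invfM mulrA.
  by apply: step => //; rewrite divr_gt0 ?exprn_gt0.
have cd0 : 0 <= (1 + `|c|) / d by rewrite ltW // divr_gt0.
move=> i; apply: near_le _ (h (Num.bound ((1 + `|c|) / d)) i).
rewrite ler_pdivrMr ?exprn_gt0 // mulrC -ler_pdivrMr //.
apply: (le_trans (ltW (archi_boundP cd0))).
by rewrite -natrX ler_nat ltnW // ltn_expl.
Qed.

Lemma natr_card_pred (T : finType) (x0 : T) : (#|T|.-1)%:R = #|T|%:R - 1 :> R.
Proof.
have h : (0 < #|T|)%N by apply/card_gt0P; exists x0.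
by rewrite -[in RHS](prednK h) -addn1 natrD addrK.
Qed.

Lemma sum_point (T : finType) (x0 : T) (a b : R) :
  \sum_x (if x == x0 then b else a) = b + (#|T|%:R - 1) * a.
Proof.
rewrite (bigD1 x0) //= eqxx (eq_bigr (fun=> a)) => [|x /negbTE -> //].
by rewrite sumr_const cardC1 -[a *+ _]mulr_natl (natr_card_pred x0).
Qed.

Lemma natr_card_set (T : finType) (S : pred T) :
  #|[set x | S x]|%:R = \sum_x (if S x then 1 else 0) :> R.
Proof. by rewrite -big_mkcond -sum1dep_card natr_sum. Qed.

Lemma sum_half (T : finType) (x0 : T) (S : pred T) (b : R) :
  (2 * #|[set x : T | (x != x0) && S x]| + 1 = #|T|)%N ->
  \sum_x (if x == x0 then b else if S x then 0 else 1) = b + (#|T|%:R - 1) / 2.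
Proof.
move=> hS; have e3 : 2 * #|[set x : T | (x != x0) && S x]|%:R + 1 = #|T|%:R :> R.
  by rewrite -hS natrD natrM.
have := sum_point x0 1 b; rewrite mulr1.
rewrite (eq_bigr (fun x => (if x == x0 then b else if S x then 0 else 1)
    + (if (x != x0) && S x then 1 else 0))); last first.
  by move=> x _; case: (x == x0); case: (S x); rewrite /= ?addr0 ?add0r.
by rewrite big_split /= -natr_card_set => e; lra.
Qed.

Lemma near_zero_t P a b d1 d2 :
  (forall r, r != 0 -> has_density (fun v s t => P v s (lift r + pi * t)) a d1) ->
  has_density (fun v s t => P v s (pi * t)) b d2 ->
  has_density P (q^-1 * (b + (q - 1) * a)) (q^-1 * (d2 + (q - 1) * d1)).
Proof.
move=> h1 h2; rewrite -!(sum_point (0 : F)); apply: (near_split_t HR) => r.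
case: (eqVneq r 0) => [->|]; last exact: h1.
by apply: near_eq h2 => v s t; rewrite (lift_zero HR) add0r.
Qed.

Lemma near_zero_s P a b d1 d2 :
  (forall r, r != 0 -> has_density (fun v s t => P v (lift r + pi * s) t) a d1) ->
  has_density (fun v s t => P v (pi * s) t) b d2 ->
  has_density P (q^-1 * (b + (q - 1) * a)) (q^-1 * (d2 + (q - 1) * d1)).
Proof.
move=> h1 h2; rewrite -!(sum_point (0 : F)); apply: (near_split_s HR) => r.
case: (eqVneq r 0) => [->|]; last exact: h1.
by apply: near_eq h2 => v s t; rewrite (lift_zero HR) add0r.
Qed.

Lemma near_zero_v P a b d1 d2 :
  (forall r, r != 0 -> has_density (fun v s t => P (lift r + pi * v) s t) a d1) ->
  has_density (fun v s t => P (pi * v) s t) b d2 ->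
  has_density P (q^-1 * (b + (q - 1) * a)) (q^-1 * (d2 + (q - 1) * d1)).
Proof.
move=> h1 h2; rewrite -!(sum_point (0 : F)); apply: (near_split_v HR) => r.
case: (eqVneq r 0) => [->|]; last exact: h1.
by apply: near_eq h2 => v s t; rewrite (lift_zero HR) add0r.
Qed.

Lemma q_ge2 : 2 <= q.
Proof.
have : (1 < #|F|)%N by rewrite (cardD1 0) (cardD1 1) !inE oner_eq0.
by rewrite ler_nat.
Qed.

Lemma near_half_t P (S : pred F) b d :
  (2 * #|[set r : F | (r != 0%R) && S r]| + 1 = #|F|)%N ->
  (forall r v s t, r != 0 -> S r -> ~ P v s (lift r + pi * t)) ->
  (forall r v s t, r != 0 -> ~~ S r -> P v s (lift r + pi * t)) ->
  has_density (fun v s t => P v s (pi * t)) b d ->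
  has_density P (q^-1 * (b + (q - 1) / 2)) (q^-1 * d).
Proof.
move=> hS h0 h1 h; rewrite -(sum_half b hS).
rewrite (_ : d = \sum_(r : F) (if r == 0 then d else 0)); last by rewrite sum_point mulr0 addr0.
apply: (near_split_t HR) => r; case: (eqVneq r 0) => [->|r0].
  by apply: near_eq h => v s t; rewrite (lift_zero HR) add0r.
case: (boolP (S r)) => hr; first by apply: (near_never HR) => // v s t; apply: h0.
by apply: (near_always HR) => // v s t; apply: h1.
Qed.

Lemma near_split_st P (m d : F * F -> R) :
  (forall x, has_density (fun v s t => P v (lift x.1 + pi * s) (lift x.2 + pi * t)) (m x) (d x)) ->
  has_density P (q ^- 2 * \sum_x m x) (q ^- 2 * \sum_x d x).
Proof.
move=> h.
have e (f : F * F -> R) : q ^- 2 * \sum_x f x = q^-1 * \sum_r1 (q^-1 * \sum_r2 f (r1, r2)).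
  rewrite expr2 invfM -mulrA -mulr_sumr pair_big; congr (_ * (_ * _)).
  by apply: eq_bigr => -[].
rewrite !e; apply: (near_split_s HR) => r1.
by apply: (near_split_t HR) => r2; apply: (h (r1, r2)).
Qed.

Lemma near_split_vst P (m d : F * F * F -> R) :
  (forall x, has_density (fun v s t => P (lift x.1.1 + pi * v) (lift x.1.2 + pi * s) (lift x.2 + pi * t)) (m x) (d x)) ->
  has_density P (q ^- 3 * \sum_x m x) (q ^- 3 * \sum_x d x).
Proof.
move=> h.
have e (f : F * F * F -> R) : q ^- 3 * \sum_x f x = q^-1 * \sum_r (q ^- 2 * \sum_x f (r, x.1, x.2)).
  rewrite exprS invfM -mulrA -mulr_sumr pair_big; congr (_ * (_ * _)).
  rewrite (reindex (fun y : F * (F * F) => (y.1, y.2.1, y.2.2))); first by apply: eq_bigr => -[? []].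
  by exists (fun x : F * F * F => (x.1.1, (x.1.2, x.2))) => [[? []]|[[]]].
rewrite !e; apply: (near_split_v HR) => r.
by apply: near_split_st => x; apply: (h (r, x.1, x.2)).
Qed.

(* The branch [(pi v, pi^(n+2) s, pi^(n+3) t)], [v] a unit, where the quartic is a
   perturbation of a square over a ramified quadratic extension. *)
Definition ramified_density : R := (2 * q + 1) / (2 * (q + 1)).

Lemma q_gt0 : 0 < q.
Proof. by apply: lt_le_trans q_ge2. Qed.

Lemma card_twisted_squares (c : F) : c != 0 ->
  (2 * #|[set r : F | (r != 0%R) && `[< is_square (r * c) >]]| + 1 = #|F|)%N.
Proof.
move=> c0; rewrite -[RHS](card_nonzero_squares F2).
rewrite -(card_imset [set r : F | _] (mulIf c0)); congr (2 * _ + 1)%N.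
apply: eq_card => x; rewrite !inE; apply/imsetP/andP => [[r]|[x0 hx]].
  by rewrite inE => /andP[r0 hr] ->; rewrite mulf_neq0.
by exists (x / c); rewrite ?inE divfK // mulf_neq0 ?invr_eq0.
Qed.

Lemma ramified_near (r : F) : r != 0 -> forall d, 0 < d -> forall n,
  has_density (fun v s t => irr (pi * (lift r + pi * v)) (pi ^+ n.+2 * s) (pi ^+ n.+3 * t))
    ramified_density d.
Proof.
move=> r0; have hr v : rs (lift r + pi * v) = r.
  by rewrite rmorphD rmorphM (res_pi HR) mul0r addr0 (res_lift HR).
have ht t x : rs (lift t + pi * x) = t.
  by rewrite rmorphD rmorphM (res_pi HR) mul0r addr0 (res_lift HR).
apply: (near_limit (c := `|ramified_density|)) => // d d0 ih n.
have hq := q_ge2; have hq0 := q_gt0.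
(* The equation that determines [ramified_density]: a unit [s] gives irreducibility; otherwise half
   of the unit values of [t] do; otherwise the level rises by one. *)
have -> : ramified_density = q^-1 * (q^-1 * (ramified_density + (q - 1) / 2) + (q - 1) * 1).
  by rewrite /ramified_density; field; lra.
apply: (near_le (d := q^-1 * (q^-1 * d + (q - 1) * 0))).
  rewrite mulr0 addr0 mulrA -invfM mulrC ler_pM2l // lef_pV2 ?posrE ?mulr_gt0 //; nra.
apply: near_zero_s => [r1 r10|].
  apply: (near_always HR) => // v s t.
  by apply: (ramified_irreducible HR F2); rewrite hr ?ht //; left.
have c0 : r ^+ odd n.+1 != 0 by rewrite expf_neq0.
apply: (near_half_t (S := fun x => `[< is_square (x * r ^+ odd n.+1) >])).
- exact: card_twisted_squares.
- move=> r1 v s t r10 /asboolP hs; apply.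
  have -> : pi ^+ n.+2 * (pi * s) = pi ^+ n.+3 * s by rewrite mulrA -exprSr.
  have hn := odd_double_half n; move: hs; rewrite /=; case: (boolP (odd n)) hn => [on|on] hn /= hs.
    have -> : n.+3 = (n./2.+2 + n./2.+2)%N by rewrite -[in LHS]hn -addnn !addSn !addnS.
    apply: (split_pair_splits HR F2); rewrite ht //.
    by move: hs; rewrite expr0 mulr1.
  have -> : n.+3 = (n./2.+1 + n./2.+2)%N by rewrite -[in LHS]hn -addnn addSn !addnS add0n.
  by apply: (ramified_splits HR F2); rewrite ?hr ?ht //; move: hs; rewrite expr1 mulrC.
- move=> r1 v s t r10 /asboolP hs.
  apply: (ramified_irreducible HR F2); rewrite hr ?ht //; right.
  by exists s.
apply: near_eq (ih n.+1) => v s t.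
by congr (~ splits _ _ _); rewrite mulrA -exprSr.
Qed.

(* The branch [(v, pi^(n+1) s, pi^(n+1) t)], [v] a nonsquare unit, where the quartic is a
   perturbation of a square over the unramified quadratic extension. *)
Definition inert_density (n : nat) : R :=
  (if odd n then q ^+ 2 + 2 else 2 * q ^+ 2 + 1) / (2 * (q ^+ 2 + 1)).

Lemma inert_near (r : F) : ~ is_square r -> forall d, 0 < d -> forall n,
  has_density (fun v s t => irr (lift r + pi * v) (pi ^+ n.+1 * s) (pi ^+ n.+1 * t))
    (inert_density n) d.
Proof.
move=> hr; have ht t x : rs (lift t + pi * x) = t.
  by rewrite rmorphD rmorphM (res_pi HR) mul0r addr0 (res_lift HR).
apply: (near_limit (c := `|inert_density 0| + `|inert_density 1|)) => [n|d d0 ih n].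
  by rewrite /inert_density; case: (odd n); rewrite ?lerDl ?lerDr.
have hq := q_ge2; have hq0 := q_gt0.
have cF : #|{: F * F}|%:R = q ^+ 2 :> R by rewrite card_prod natrM -expr2.
pose m x := if x == (0, 0) then inert_density n.+1
            else if ~~ odd n.+1 && `[< square_pair r x.1 x.2 >] then 0 else 1.
(* The two values of [inert_density] solve a pair of equations in which each parity leads to the
   other: at an odd valuation [n + 1] every nonzero residue pair is irreducible, at an even one half
   of them are. *)
have -> : inert_density n = q ^- 2 * \sum_x m x.
  rewrite /m /inert_density /=; case: (odd n) => /=; last first.
    rewrite (eq_bigr (fun x => if x == (0, 0) then (q ^+ 2 + 2) / (2 * (q ^+ 2 + 1)) else 1)) => [|x _].
      by rewrite sum_point cF; field; nra.
    by [].
  rewrite sum_half; last by rewrite card_prod mulnn; apply: card_square_pairs.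
  by rewrite cF; field; nra.
apply: (near_le (d := q ^- 2 * \sum_(x : F * F) if x == (0, 0) then d else 0)).
  rewrite sum_point mulr0 addr0 mulrC ler_pM2l // lef_pV2 ?posrE ?exprn_gt0 //; nra.
apply: near_split_st => -[r1 r2]; rewrite /m; case: eqP => [[-> ->]|/eqP r12] /=.
  apply: near_eq (ih n.+1) => v s t; rewrite (lift_zero HR) !add0r.
  by congr (~ splits _ _ _); rewrite mulrA -exprSr.
have r12' : r1 != 0 \/ r2 != 0.
  by apply/orP; move: r12; rewrite xpair_eqE negb_and.
case: (boolP (odd n)) => on /=; last first.
  apply: (near_always HR) => // v s t.
  by apply: (inert_irreducible HR F2); rewrite !ht //= on.
case: asboolP => hsq.
  apply: (near_never HR) => // v s t; apply.
  have -> : n.+1 = (n./2.+1 + n./2.+1)%N.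
    by rewrite -[in LHS](odd_double_half n) on -addnn !addSn !addnS.
  by apply: (inert_splits HR F2); rewrite !ht.
apply: (near_always HR) => // v s t.
by apply: (inert_irreducible HR F2); rewrite !ht //= on.
Qed.

(* The density inside the residue class [(0, 0, 0)], as a function of the full density [m]. *)
Definition nilpotent_density (m : R) : R :=
  q^-1 * (q^-1 * (q^-1 * (q^-1 * (q^-1 * (q^-1 * (m + (q - 1))) + (q - 1) * ramified_density)
     + (q - 1) / 2)) + (q - 1)).

Lemma nilpotent_near m d : 0 < d ->
  has_density (fun v s t => irr v s t) m d ->
  has_density (fun v s t => irr (pi * v) (pi * s) (pi * t)) (nilpotent_density m) d.
Proof.
move=> d0 h; have hq := q_ge2; have hq0 := q_gt0.
have ht t x : rs (lift t + pi * x) = t.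
  by rewrite rmorphD rmorphM (res_pi HR) mul0r addr0 (res_lift HR).
have avg : q^-1 * (d + (q - 1) * d) = d by field; lra.
have d0' := ltW d0.
(* The examinations are treated from the last to the first: [h6] is the state before the sixth. The
   error [d] survives each average. *)
have h6 : has_density (fun v s t => irr (pi ^+ 2 * v) (pi ^+ 3 * s) (pi ^+ 3 * t))
    (q^-1 * (m + (q - 1) * 1)) d.
  apply: (near_le (d := q^-1 * (d + (q - 1) * d))); first by rewrite avg.
  apply: near_zero_t => [r r0|].
    by apply: (near_always HR) => // v s t; apply: (slope_irreducible HR F2); rewrite ht.
  apply: near_iff h => v s t; rewrite -(splits_scale HR F2 v s t).
  by rewrite (_ : pi ^+ 3 * (pi * t) = pi ^+ 4 * t) //; ring.
have h5 : has_density (fun v s t => irr (pi ^+ 2 * v) (pi ^+ 2 * s) (pi ^+ 3 * t))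
    (q^-1 * (q^-1 * (m + (q - 1) * 1) + (q - 1) * 0)) d.
  apply: (near_le (d := q^-1 * (d + (q - 1) * d))); first by rewrite avg.
  apply: near_zero_s => [r r0|].
    by apply: (near_never HR) => // v s t; apply; apply: (slope_splits HR); rewrite ht.
  by apply: near_eq h6 => v s t; congr (~ splits _ _ _); ring.
have h4 : has_density (fun v s t => irr (pi * v) (pi ^+ 2 * s) (pi ^+ 3 * t))
    (q^-1 * (q^-1 * (q^-1 * (m + (q - 1) * 1) + (q - 1) * 0) + (q - 1) * ramified_density)) d.
  apply: (near_le (d := q^-1 * (d + (q - 1) * d))); first by rewrite avg.
  apply: near_zero_v => [r r0|]; first exact: (ramified_near r0 d0 0).
  by apply: near_eq h5 => v s t; congr (~ splits _ _ _); ring.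
have h3 : has_density (fun v s t => irr (pi * v) (pi ^+ 2 * s) (pi ^+ 2 * t))
    (q^-1 * (q^-1 * (q^-1 * (q^-1 * (m + (q - 1) * 1) + (q - 1) * 0) + (q - 1) * ramified_density)
     + (q - 1) / 2)) d.
  apply: (near_le (d := q^-1 * d)).
    by rewrite ler_piMl // invf_le1 //; lra.
  apply: (near_half_t (S := fun x => `[< is_square x >])).
  - exact: (card_nonzero_squares F2).
  - move=> r v s t r0 /asboolP hs; apply.
    by apply: (split_pair_splits HR F2 0); rewrite ht.
  - by move=> r v s t r0 /asboolP hs; apply: (split_pair_irreducible HR F2); rewrite ht.
  by apply: near_eq h4 => v s t; congr (~ splits _ _ _); ring.
have h2 : has_density (fun v s t => irr (pi * v) (pi * s) (pi ^+ 2 * t))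
    (q^-1 * (q^-1 * (q^-1 * (q^-1 * (q^-1 * (m + (q - 1) * 1) + (q - 1) * 0) + (q - 1) * ramified_density)
     + (q - 1) / 2) + (q - 1) * 0)) d.
  apply: (near_le (d := q^-1 * (d + (q - 1) * d))); first by rewrite avg.
  apply: near_zero_s => [r r0|].
    by apply: (near_never HR) => // v s t; apply; apply: (simple_root_splits HR); rewrite ht.
  by apply: near_eq h3 => v s t; congr (~ splits _ _ _); ring.
have -> : nilpotent_density m = q^-1 * (q^-1 * (q^-1 * (q^-1 * (q^-1 * (q^-1 * (m + (q - 1) * 1) + (q - 1) * 0) + (q - 1) * ramified_density)
     + (q - 1) / 2) + (q - 1) * 0) + (q - 1) * 1) by rewrite /nilpotent_density !mulr0 !addr0 !mulr1.
apply: (near_le (d := q^-1 * (d + (q - 1) * d))); first by rewrite avg.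
apply: near_zero_t => [r r0|].
  by apply: (near_always HR) => // v s t; apply: (eisenstein_irreducible HR F2); rewrite ht.
by apply: near_eq h2 => v s t; congr (~ splits _ _ _); ring.
Qed.

Definition irreducible_density : R :=
  (q ^+ 12 + q ^+ 11 + 2 * q ^+ 10 + 4 * q ^+ 9 - 2 * q ^+ 8 + q ^+ 7
    + 3 * q ^+ 6 - 6 * q ^+ 5 + 6 * q ^+ 4 - 4 * q ^+ 3 - 2 * q ^+ 2 - 4)
   / (4 * (q + 1) * (q ^+ 2 + 1) * (q ^+ 9 - 1)).

(** The terms come from the irreducible residues, from [y^4], and from the [(q - 1) / 2] squares of
    irreducible quadratics. The unknown has coefficient [q^-9], namely [q^-3] for its class and
    [q^-6] for the six examinations, whence the factor [q^9 - 1]. *)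
Lemma irreducible_density_eq : irreducible_density =
  q ^- 3 * ((q ^+ 3 - q) / 4 + nilpotent_density irreducible_density + (q - 1) / 2 * inert_density 0).
Proof.
have hq := q_ge2.
have q9 : q ^+ 9 - 1 != 0.
  by rewrite subr_eq0 gt_eqF // exprn_egt1 //; lra.
rewrite /nilpotent_density /ramified_density /inert_density /irreducible_density /=.
field; rewrite q9 /=; apply/and3P; split; apply/eqP; nra.
Qed.

Lemma irreducible_near : forall d, 0 < d -> has_density (fun v s t : A => irr v s t) irreducible_density d.
Proof.
suff h : forall d, 0 < d -> forall i : unit, has_density (fun v s t : A => irr v s t) irreducible_density d.
  by move=> d d0; apply: h d0 tt.
apply: (near_limit (P := fun _ => _) (m := fun _ => _) (c := `|irreducible_density|)) => // d d0 /(_ tt) ih _.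
have hq := q_ge2; have hq0 := q_gt0.
have ht t x : rs (lift t + pi * x) = t.
  by rewrite rmorphD rmorphM (res_pi HR) mul0r addr0 (res_lift HR).
(* The classes other than [(0, 0, 0)] are known to any precision. With [d / 4] there, and [d] on a
   class of weight at most 1/8, the average stays below [d / 2]. *)
have d4 : 0 < d / 4 by lra.
pose S (x : F * F * F) := `[< splits x.1.1 x.1.2 x.2 >].
pose E (x : F * F * F) := [&& x.1.2 == 0, x.2 == 0 & ~~ `[< is_square x.1.1 >]].
pose m x := (if ~~ S x then 1 else 0) + (if x == (0, 0, 0) then nilpotent_density irreducible_density else 0)
   + (if E x then inert_density 0 else 0).
have sum_m : \sum_x m x = (q ^+ 3 - q) / 4 + nilpotent_density irreducible_density + (q - 1) / 2 * inert_density 0.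
  rewrite !big_split /= -natr_card_set sum_point mulr0 addr0; congr (_ + _ + _).
    have := congr1 (fun n => n%:R : R) (card_irreducible F2).
    by rewrite /S natrD natrM natrX => e; lra.
  rewrite -[inert_density 0]mul1r (eq_bigr (fun x => (if E x then 1 else 0) * inert_density 0)); last first.
    by move=> x _; case: (E x); rewrite ?mul1r ?mul0r.
  rewrite -mulr_suml -natr_card_set mul1r; congr (_ * _).
  have -> : #|[set x | E x]| = #|[set x : F | ~~ `[< is_square x >]]|.
    rewrite -(card_imset [set x : F | _] (f := fun v => (v, 0, 0) : F * F * F)); last by move=> ? ? [].
    apply: eq_card => -[[v s] t]; rewrite !inE /E /=; apply/and3P/imsetP => [[/eqP -> /eqP -> hv]|[v' ]].
      by exists v; rewrite ?inE.
    by rewrite inE => hv [-> -> ->].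
  have := congr1 (fun n => n%:R : R) (card_nonsquares F2).
  by rewrite natrD natrM => e; lra.
rewrite irreducible_density_eq -sum_m.
apply: (near_le (d := q ^- 3 * \sum_(x : F * F * F) if x == (0, 0, 0) then d else d / 4)).
  rewrite sum_point !card_prod !natrM.
  have q3 : 8 <= q ^+ 3 by rewrite (_ : 8 = 2 ^+ 3) ?lerXn2r ?nnegrE //; lra.
  have -> : q * q * q = q ^+ 3 by ring.
  rewrite mulrC ler_pdivrMr //; [nra|lra].
apply: near_split_vst => x; rewrite /m.
case: (eqVneq x (0, 0, 0)) => [->|x0].
  have -> : S (0, 0, 0) by apply/asboolP; right; exists 0, 0; rewrite /=; split; ring.
  have -> : E (0, 0, 0) = false.
    by rewrite /E /= !eqxx /=; apply/negbF/asboolP; exists 0; rewrite expr0n.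
  rewrite /= add0r addr0.
  apply: near_eq (nilpotent_near d0 ih) => v s t.
  by rewrite (lift_zero HR) !add0r.
case: (boolP (E x)) => hE.
  move: hE => /and3P[/eqP hs /eqP h2 /asboolPn hv].
  have -> : S x by rewrite /S hs h2; apply/asboolP; right; exists 0, 0; rewrite /=; split; ring.
  rewrite /= !add0r; apply: near_eq (inert_near hv d4 0) => v s t.
  by rewrite hs h2 (lift_zero HR) !add0r expr1.
rewrite !addr0; case: (boolP (S x)) => hS /=.
  apply: (near_never HR) => [|v s t]; first exact: ltW.
  apply; apply: (splits_of_residue HR F2); rewrite !ht; first exact/asboolP.
  move=> [hs [h2 hv]]; case: hv => hv.
    by move: x0; case: x hs h2 hv {hE hS} => [[a b] c] /= -> -> ->; rewrite eqxx.
  by move/negP: hE; apply; rewrite /E hs h2 !eqxx /=; apply/asboolPn.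
apply: (near_always HR) => [|v s t]; first exact: ltW.
by move/(splits_residue rs); rewrite !ht => h; move/asboolPn: hS; apply.
Qed.

End Density.

(** * The p-adic integers as a henselian ring *)

Section ZpStructure.
Variable p : nat.
Hypothesis hp : prime p.
Local Notation Zp := (Zpadic p).
Local Notation M := (zp_mod p).

Lemma zp_baseE : zp_base p = p.
Proof. by apply/maxn_idPl; apply: prime_gt1. Qed.

Lemma zp_modE n : M n = (p ^ n)%N%:Z.
Proof. by rewrite /zp_mod zp_baseE. Qed.

Lemma zp_modS n : M n.+1 = p%:Z * M n.
Proof. by rewrite !zp_modE expnS PoszM. Qed.

Lemma zp_mod_gt0 n : 0 < M n.
Proof. by rewrite zp_modE ltz_nat expn_gt0 prime_gt0. Qed.

Lemma zpval_le (x : Zp) m n : (m <= n)%N -> zpval x m = (zpval x n %% M m)%Z.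
Proof.
move=> /subnK <-; elim: (n - m)%N => [|k ih]; first by rewrite zp_vmod.
rewrite addSn ih (zpvalP x (k + m)%N) mod_mod_dvd //.
elim: k {ih} => [|k ih]; first by rewrite dvdzz.
by rewrite addSn zp_modS dvdz_mull.
Qed.

Lemma zpval_nat k n : zpval (k%:R : Zp) n = (k%:Z %% M n)%Z.
Proof.
elim: k => [|k ih]; first by rewrite mod0z.
rewrite -addn1 natrD [LHS]/= ih modzDml.
by rewrite modzDmr PoszD.
Qed.

Lemma zpval_ppow k n : zpval ((p%:R : Zp) ^+ k) n = (M k %% M n)%Z.
Proof. by rewrite -natrX zpval_nat !zp_modE. Qed.

Lemma congruent_zpval n (x y : Zp) : congruent (p%:R : Zp) n x y <-> zpval x n = zpval y n.
Proof.
split=> [[z ->]|].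
  rewrite [LHS]/= zpval_ppow modzz mul0r mod0z addr0.
  exact: zp_vmod.
suff h : forall z : Zp, zpval z n = 0 -> exists w, z = p%:R ^+ n * w.
  move=> e; have [|w hw] := h (x - y).
    by rewrite [LHS]/= modzDmr e subrr mod0z.
  by exists w; rewrite -hw addrC subrK.
elim: n => [|n ih] z hz; first by exists z; rewrite expr0 mul1r.
have p0 : p%:Z != 0 by rewrite eqz_nat -lt0n prime_gt0.
have pdvd k : (p%:Z %| zpval z k.+1)%Z.
  have : zpval z 1 = 0 by rewrite (@zpval_le z 1 n.+1) // hz mod0z.
  rewrite (@zpval_le z 1 k.+1) // zp_modE expn1 => h.
  exact/dvdz_mod0P.
(* The quotient by [p] at level [k] is read off from [z] at level [k + 1]. *)
have wv : zp_valid p (fun k => (zpval z k.+1 %/ p%:Z)%Z).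
  move=> k; apply: (mulfI p0).
  rewrite mulz_modr ?ltz_nat ?prime_gt0 // -zp_modS ![p%:Z * _]mulrC !divzK //.
  exact: zpvalP.
have ez : z = p%:R * MkZp wv.
  apply: zp_eq => k /=; rewrite zpval_nat modzMml.
  rewrite mulrC divzK //; exact: zpvalP.
have [|w hw] := ih (MkZp wv).
  by rewrite /= hz div0z.
by exists w; rewrite ez hw exprS mulrA.
Qed.

Lemma zp_limit (a : nat -> Zp) : (forall n, zpval (a n.+1) n = zpval (a n) n) ->
  exists x : Zp, forall n, zpval x n = zpval (a n) n.
Proof.
move=> h; have v : zp_valid p (fun n => zpval (a n) n).
  by move=> n; rewrite -(zpvalP (a n.+1) n) h.
by exists (MkZp v).
Qed.

(** Picard iteration from [(0, 0)]: the factor [p] makes each step fix one more digit, so the [n]-th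
    iterate is final modulo [p^n]. *)
Lemma zp_fixpoint (c d : Zp) (f g : Zp -> Zp -> Zp) :
  (forall n x y x' y', congruent (p%:R : Zp) n x x' -> congruent (p%:R : Zp) n y y' ->
     congruent (p%:R : Zp) n (f x y) (f x' y')) ->
  (forall n x y x' y', congruent (p%:R : Zp) n x x' -> congruent (p%:R : Zp) n y y' ->
     congruent (p%:R : Zp) n (g x y) (g x' y')) ->
  exists x y, x = c + p%:R * f x y /\ y = d + p%:R * g x y.
Proof.
move=> hf hg.
have step n (e : Zp) a b : congruent (p%:R : Zp) n a b ->
    congruent (p%:R : Zp) n.+1 (e + p%:R * a) (e + p%:R * b).
  by case=> z ->; exists z; rewrite exprS; ring.
pose a n := iter n (fun x : Zp * Zp => (c + p%:R * f x.1 x.2, d + p%:R * g x.1 x.2)) (0, 0).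
have ha n : congruent (p%:R : Zp) n (a n.+1).1 (a n).1 /\ congruent (p%:R : Zp) n (a n.+1).2 (a n).2.
  elim: n => [|n [ih1 ih2]]; last by split; apply: step; [apply: hf|apply: hg].
  by split; apply/congruent_zpval; rewrite !(@zpval_le _ 0 1) // zp_modE expn0 !modz1.
have [x hx] := @zp_limit (fun n => (a n).1) (fun n => (congruent_zpval _ _ _).1 (ha n).1).
have [y hy] := @zp_limit (fun n => (a n).2) (fun n => (congruent_zpval _ _ _).1 (ha n).2).
have [cx cy] : (forall n, congruent (p%:R : Zp) n x (a n).1) /\ (forall n, congruent (p%:R : Zp) n y (a n).2).
  by split=> n; apply/congruent_zpval.
have down n (z w : Zp) : congruent (p%:R : Zp) n.+1 z w -> zpval z n = zpval w n.
  by move/congruent_zpval => e; rewrite !(@zpval_le _ n n.+1) // e.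
exists x, y; split; apply: zp_eq => n.
  transitivity (zpval (a n.+1).1 n); first exact/down/cx.
  by apply/esym/down/step/hf.
transitivity (zpval (a n.+1).2 n); first exact/down/cy.
by apply/esym/down/step/hg.
Qed.

Lemma zpval_pmul (x : Zp) n : zpval (p%:R * x) n.+1 = p%:Z * zpval x n.
Proof.
rewrite [LHS]/= zpval_nat modzMml zp_modS -mulz_modr ?ltz_nat ?prime_gt0 //.
by rewrite -(@zpval_le x n n.+1).
Qed.

(** The primality proof is an argument so that the morphism structures, which rely on it, can be
    attached to [zp_res hp]. *)
Definition zp_res of prime p := fun x : Zp => ((zpval x 1)%:~R : 'F_p).

Lemma Fp_intr_mod (z : int) : (z %% M 1)%Z%:~R = z%:~R :> 'F_p.
Proof.
rewrite [in RHS](divz_eq z (M 1)) [RHS]intrD [X in _ = X + _]intrM zp_modE expn1.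
by rewrite -[X in _ * X + _]/(p%:R) (pcharf0 (pchar_Fp hp)) mulr0 add0r.
Qed.

Lemma zp_res_zmod : zmod_morphism (zp_res hp).
Proof.
by move=> x y; rewrite /zp_res [zpval _ 1]/= Fp_intr_mod rmorphD /= Fp_intr_mod rmorphN.
Qed.

Lemma zp_res_monoid : monoid_morphism (zp_res hp).
Proof.
split=> [|x y]; rewrite /zp_res [zpval _ 1]/= Fp_intr_mod //.
by rewrite rmorphM.
Qed.

HB.instance Definition _ := GRing.isZmodMorphism.Build Zp 'F_p (zp_res hp) zp_res_zmod.
HB.instance Definition _ := GRing.isMonoidMorphism.Build Zp 'F_p (zp_res hp) zp_res_monoid.

Definition zp_lift (a : 'F_p) : Zp := (a : nat)%:R.

Lemma zp_henselian : henselian (p%:R : Zp) (zp_res hp : {rmorphism Zp -> 'F_p}) zp_lift.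
Proof.
have hl a : zp_res hp (zp_lift a) = a.
  by rewrite rmorph_nat; apply: natr_Zp.
have hpi : zp_res hp p%:R = 0 by rewrite rmorph_nat (pcharf0 (pchar_Fp hp)).
have h0 x : zp_res hp x = 0 -> exists y, x = p%:R * y.
  move=> e; suff /congruent_zpval [z ->] : zpval x 1 = zpval (0 : Zp) 1 by exists z; rewrite add0r expr1.
  have [k hk] : exists k : nat, zpval x 1 = k.
    exists `|zpval x 1|%N; rewrite gez0_abs // -(zp_vmod x 1).
    by rewrite modz_ge0 // gt_eqF // zp_mod_gt0.
  move/eqP: e; rewrite /zp_res hk -[_%:~R]/(k%:R) -(dvdn_pcharf (pchar_Fp hp)) => /eqP pk.
  have := zp_vmod x 1; rewrite hk zp_modE expn1 modz_nat pk => <-.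
  by rewrite /=.
split=> //.
- move=> x y e; apply: zp_eq => n.
  have p0 : p%:Z != 0 by rewrite eqz_nat -lt0n prime_gt0.
  by apply: (mulfI p0); rewrite -!zpval_pmul e.
- move=> x x0; have [e he] : exists e, x * zp_lift (zp_res hp x)^-1 = 1 + p%:R * e.
    have [|e he] := h0 (x * zp_lift (zp_res hp x)^-1 - 1).
      by rewrite rmorphB rmorphM /= hl rmorph1 mulfV // subrr.
    by exists e; rewrite -he addrC subrK.
  (* The inverse of [1 + p e] is the solution of [u = 1 - p e u]; the second unknown is a dummy. *)
  have [||u [_ [hu _]]] := @zp_fixpoint 1 0 (fun u _ => - e * u) (fun u _ => u).
  + by move=> n *; congruence_of_polynomials.
  + by [].
  exists (zp_lift (zp_res hp x)^-1 * u); rewrite mulrA he mulrDl mul1r {1}hu; ring.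
exact: zp_fixpoint.
Qed.

Lemma zp_unit_or_pi (x : Zp) : x != 0 -> exists n u w, x = p%:R ^+ n * u /\ u * w = 1.
Proof.
move=> x0; have [n hn] : exists n, zpval x n <> 0.
  by apply/existsNP => h; move/eqP: x0; apply; apply: zp_eq => n; rewrite h.
elim: n x {x0} hn => [|n ih] x hx.
  by case: hx; rewrite -zp_vmod zp_modE expn0 modz1.
case: (eqVneq (zp_res hp x) 0) => [/(res_eq0 zp_henselian) [y hy]|h]; last first.
  by have [w hw] := res_unit zp_henselian h; exists 0%N, x, w; rewrite expr0 mul1r.
have [|m [u [w [e1 e2]]]] := ih y.
  by move=> y0; apply: hx; rewrite hy zpval_pmul y0 mulr0.
by exists m.+1, u, w; split=> //; rewrite hy e1 exprS mulrA.
Qed.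

(** A nonzero element is a power of [p] times a unit, and both factors can be cancelled. This makes
    the degrees of the factors of a quartic add up. *)
Lemma zp_mul_eq0 (x y : Zp) : x * y = 0 -> x = 0 \/ y = 0.
Proof.
move=> xy; case: (eqVneq x 0) => [|x0]; [by left|right].
have [n [u [w [e1 e2]]]] := zp_unit_or_pi x0.
have h : p%:R ^+ n * y = 0.
  by rewrite -[RHS](mulr0 w) -xy e1 -[y in LHS]mul1r -e2; ring.
elim: n {e1} h => [|n ih]; first by rewrite expr0 mul1r.
rewrite exprS -mulrA => h; apply: ih; apply: (pi_inj zp_henselian).
by rewrite h mulr0.
Qed.

End ZpStructure.

(** * The depressed form and the factorizations of monic quartics *)

Section Depression.
Variable p : nat.
Hypothesis hp : prime p.
Hypothesis hodd : odd p.
Local Notation Zp := (Zpadic p).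

(* The coefficients of [((x + u)^2 - v)^2 - s (x + u) - t]. *)
Definition undepress (u v s t : Zp) : 'I_4 -> Zp :=
  fun i => [tuple (u ^+ 2 - v) ^+ 2 - s * u - t; 4 * u * (u ^+ 2 - v) - s;
                  6 * u ^+ 2 - 2 * v; 4 * u]`_i.

Lemma Fp_two_neq0 : (2 : 'F_p) != 0.
Proof.
rewrite -(dvdn_pcharf (pchar_Fp hp)); apply/negP => /(dvdn_leq (isT : (0 < 2)%N)) h.
have := prime_gt1 hp; move: hodd h; case: (p) => [|[|[|]]] //.
Qed.

Lemma zp_half : exists h : Zp, 2 * h = 1.
Proof.
apply: (res_unit (zp_henselian hp)).
by rewrite rmorph_nat Fp_two_neq0.
Qed.

Lemma monic_quarticE (c : 'I_4 -> Zp) : monic_quartic c = 'X^4 + c (inord 3) *: 'X^3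
  + c (inord 2) *: 'X^2 + c (inord 1) *: 'X + (c (inord 0))%:P.
Proof.
rewrite /monic_quartic !big_ord_recl big_ord0 addr0 expr0 expr1 alg_polyC.
have e (i : 'I_4) k : i = k :> nat -> c i = c (inord k).
  by move=> <-; rewrite inord_val.
rewrite !(e ord0 0%N, e (lift ord0 ord0) 1%N, e (lift ord0 (lift ord0 ord0)) 2%N, e (lift ord0 (lift ord0 (lift ord0 ord0))) 3%N) //=.
ring.
Qed.

Lemma undepress_surj (c : 'I_4 -> Zp) : exists u v s t, c = undepress u v s t.
Proof.
have [h h2] := zp_half.
pose c' k := c (inord k).
(* The coefficients are solved from the top one down; [h * h] is the inverse of 4. *)
pose u := h * h * c' 3%N; pose v := h * (6 * u ^+ 2 - c' 2%N).
pose s := 4 * u * (u ^+ 2 - v) - c' 1%N.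
pose t := (u ^+ 2 - v) ^+ 2 - s * u - c' 0%N.
exists u, v, s, t; apply: funext => i.
have -> : c i = c' i by rewrite /c' inord_val.
case: i => [[|[|[|[|i]]]] hi] //; rewrite /undepress /= /t /s; try ring.
- rewrite /v; transitivity (6 * u ^+ 2 - (2 * h) * (6 * u ^+ 2 - c' 2%N)); [by rewrite h2; ring|ring].
- rewrite /u; transitivity ((2 * h) * (2 * h) * c' 3%N); [by rewrite h2; ring|ring].
Qed.

(** This is how the change of variables respects volumes: a box maps into a ball of the same level,
    so covers by boxes become covers by balls. *)
Lemma congruent_undepress n u v s t u' v' s' t' :
  congruent (p%:R : Zp) n u u' -> congruent (p%:R : Zp) n v v' ->
  congruent (p%:R : Zp) n s s' -> congruent (p%:R : Zp) n t t' ->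
  forall i, congruent (p%:R : Zp) n (undepress u v s t i) (undepress u' v' s' t' i).
Proof.
by move=> hu hv hs ht [[|[|[|[|i]]]] hi] //; rewrite /undepress /=; congruence_of_polynomials.
Qed.

Lemma monic_quartic_undepress u v s t : monic_quartic (undepress u v s t) =
  (('X + u%:P) ^+ 2 - v%:P) ^+ 2 - s%:P * ('X + u%:P) - t%:P.
Proof.
rewrite monic_quarticE /undepress !inordK //= -!mul_polyC.
rewrite !(polyCB, polyCD, polyCM, polyCN, rmorphXn, rmorph_nat) /=.
ring.
Qed.

Lemma size_monic_quartic (c : 'I_4 -> Zp) : size (monic_quartic c) = 5%N /\ lead_coef (monic_quartic c) = 1.
Proof.
have h : (size (\sum_(i < 4) c i *: 'X^i)%R < size ('X^4 : {poly Zp}))%N.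
  rewrite size_polyXn ltnS (leq_trans (size_sum _ _ _)) //.
  apply/bigmax_leqP => i _; rewrite (leq_trans (size_scale_leq _ _)) // size_polyXn.
  by case: i.
rewrite /monic_quartic; split; first by rewrite size_polyDl // size_polyXn.
by rewrite lead_coefDl // lead_coefXn.
Qed.

Lemma splits_reducible u v s t :
  splits v s t -> ~ zp_irreducible (monic_quartic (undepress u v s t)).
Proof.
move=> h; apply; have [s5 _] := size_monic_quartic (undepress u v s t).
have e := monic_quartic_undepress u v s t.
case: h => [[r hr]|[k [l [hs ht]]]].
  have /factor_theorem [g hg] : root (monic_quartic (undepress u v s t)) (r - u).
    rewrite /root e !(hornerE, horner_exp) subrK hr; apply/eqP; ring.
  exists g, ('X - (r - u)%:P); rewrite size_XsubC; split; last by [].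
  have g0 : g != 0.
    by apply/eqP => g0; move: s5; rewrite hg g0 mul0r size_poly0.
  by move: s5; rewrite hg size_Mmonic ?monicXsubC // size_XsubC addn2 /= => -[->].
have size3 (a b : Zp) : size (('X + u%:P) ^+ 2 + a%:P * ('X + u%:P) + b%:P) = 3%N.
  have s2 : size ('X + u%:P) = 2%N by rewrite size_XaddC.
  have sa : (size (a%:P * ('X + u%:P))%R <= 2)%N.
    by rewrite mul_polyC (leq_trans (size_scale_leq _ _)) // s2.
  have mX : 'X + u%:P \is monic by rewrite -[u]opprK polyCN monicXsubC.
  have sq : size (('X + u%:P) ^+ 2) = 3%N.
    by rewrite expr2 size_Mmonic ?monic_neq0 // s2.
  rewrite -addrA size_polyDl // sq ltnS (leq_trans (size_polyD _ _)) // geq_max sa /=.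
  by rewrite size_polyC; case: (_ != _).
exists (('X + u%:P) ^+ 2 + (2 * k)%:P * ('X + u%:P) + (2 * k ^+ 2 - v + l)%:P),
       (('X + u%:P) ^+ 2 + (- 2 * k)%:P * ('X + u%:P) + (2 * k ^+ 2 - v - l)%:P).
rewrite !size3; do 2 split => //; rewrite e hs ht.
rewrite !(polyCB, polyCD, polyCM, polyCN, rmorphXn, rmorph_nat) /=.
ring.
Qed.

(** The leading coefficients of the two factors are inverse to each other, so a linear factor can be
    solved for its root. *)
Lemma linear_factor_root (f g : {poly Zp}) : size f = 2%N -> lead_coef f * lead_coef g = 1 ->
  exists x, (f * g).[x] = 0.
Proof.
move=> sf; rewrite /lead_coef sf /=; set b := g`_ _ => hb.
exists (- f`_0 * b); rewrite hornerM (horner_coef f) sf !big_ord_recl big_ord0 /=.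
rewrite (_ : f`_0 * _ + _ = f`_0 - f`_1 * b * f`_0); last by rewrite /bump /= expr0 expr1; ring.
by rewrite hb mul1r subrr mul0r.
Qed.

Lemma root_splits u v s t x : (monic_quartic (undepress u v s t)).[x] = 0 -> splits v s t.
Proof.
rewrite monic_quartic_undepress !(hornerE, horner_exp) => h; left; exists (x + u).
by apply/eqP; rewrite -subr_eq0 -[X in _ == X]h; apply/eqP; ring.
Qed.

Lemma coef_monic_quartic (c : 'I_4 -> Zp) (i : 'I_4) : (monic_quartic c)`_i = c i.
Proof.
rewrite /monic_quartic coefD coefXn (ltn_eqF (ltn_ord i)) add0r coef_sum (bigD1 i) //=.
rewrite coefZ coefXn eqxx mulr1 big1 ?addr0 // => j ji.
by rewrite coefZ coefXn eq_sym (inj_eq val_inj) (negbTE ji) mulr0.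
Qed.

Lemma quadratic_factors_split (u v s t f0 f1 f2 g0 g1 g2 : Zp) :
  f2 * g2 = 1 -> 4 * u = f1 * g2 + f2 * g1 ->
  6 * u ^+ 2 - 2 * v = f0 * g2 + f1 * g1 + f2 * g0 ->
  4 * u * (u ^+ 2 - v) - s = f0 * g1 + f1 * g0 ->
  (u ^+ 2 - v) ^+ 2 - s * u - t = f0 * g0 -> splits v s t.
Proof.
move=> hfg e3 e2 e1 e0; have [h h2] := zp_half.
(* [a] and [b] are the coefficients of the first factor made monic; [k] and [l] come from matching
   [x^2 + a x + b] with [(x + u)^2 + 2 k (x + u) + 2 k^2 - v + l]. *)
pose a := f1 * g2; pose b := f0 * g2; pose a' := g1 * f2; pose b' := g0 * f2.
pose k := h * a - u; pose l := b - u ^+ 2 - 2 * k * u - 2 * k ^+ 2 + v.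
have ea : a = 2 * (k + u) by rewrite /k subrK mulrA h2 mul1r.
have ea' : a' = 2 * (u - k).
  have -> : a' = 4 * u - a by rewrite e3 /a /a'; ring.
  by rewrite ea; ring.
have eb : b = l + u ^+ 2 + 2 * k * u + 2 * k ^+ 2 - v by rewrite /l; ring.
have eb' : b' = 6 * u ^+ 2 - 2 * v - b - a * a'.
  by rewrite e2 -[f1 * g1]mul1r -hfg /a /a' /b /b'; ring.
have es : s = 4 * u * (u ^+ 2 - v) - (b * a' + a * b').
  transitivity (4 * u * (u ^+ 2 - v) - (4 * u * (u ^+ 2 - v) - s)); first by ring.
  by rewrite e1 -[f0 * g1]mul1r -[f1 * g0]mul1r -hfg /a /a' /b /b'; ring.
have et : t = (u ^+ 2 - v) ^+ 2 - s * u - b * b'.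
  transitivity ((u ^+ 2 - v) ^+ 2 - s * u - ((u ^+ 2 - v) ^+ 2 - s * u - t)); first by ring.
  by rewrite e0 -[f0 * g0]mul1r -hfg /b /b'; ring.
move: (a) (a') (b) (b') (l) ea ea' eb eb' es et => A A' B B' L -> -> -> -> -> ->.
by right; exists k, L; split; ring.
Qed.

Lemma reducible_splits u v s t :
  ~ zp_irreducible (monic_quartic (undepress u v s t)) -> splits v s t.
Proof.
move=> /contrapT [f [g [sf [sg e]]]].
have [s5 l1] := size_monic_quartic (undepress u v s t).
have fg0 : lead_coef f * lead_coef g != 0.
  apply/eqP => /(zp_mul_eq0 hp) [] /eqP; rewrite lead_coef_eq0 => /eqP h.
    by rewrite h size_poly0 in sf.
  by rewrite h size_poly0 in sg.
have hs : (size f + size g = 6)%N.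
  by move: s5; rewrite e size_proper_mul //; move: (size f) (size g) sf sg => a b; lia.
have hl : lead_coef f * lead_coef g = 1 by rewrite -lead_coef_proper_mul // -e.
have hroot x : (f * g).[x] = 0 -> splits v s t by rewrite -e; apply: root_splits.
have [sf2|sf4|sf3] : [\/ size f = 2%N, size g = 2%N | size f = 3%N /\ size g = 3%N].
- by move: (size f) (size g) sf sg hs => [|[|[|[|[|[|a]]]]]] [|[|[|[|[|[|b]]]]]] //; try lia; constructor.
- by have [x] := linear_factor_root sf2 hl; apply: hroot.
- by have [x] := linear_factor_root sf4 (etrans (mulrC _ _) hl); rewrite mulrC; apply: hroot.
have [sf3' sg3] := sf3.
move: hl; rewrite /lead_coef sf3' sg3 /= => hl.
have f0 k : (2 < k)%N -> f`_k = 0 by move=> h; rewrite nth_default // sf3'.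
have g0 k : (2 < k)%N -> g`_k = 0 by move=> h; rewrite nth_default // sg3.
have cf (i : 'I_4) := congr1 (fun P : {poly Zp} => P`_i) e.
have c3 := cf (@Ordinal 4 3 isT); have c2 := cf (@Ordinal 4 2 isT).
have c1 := cf (@Ordinal 4 1 isT); have c0 := cf (@Ordinal 4 0 isT).
move: c3 c2 c1 c0 {cf}; rewrite !coef_monic_quartic !coefM !big_ord_recl !big_ord0 /= /bump /=.
rewrite /undepress /= (f0 3%N) // (g0 3%N) // !(subn0, subnn) /=.
rewrite mulr0 mul0r !addr0 add0r !addrA => c3 c2 c1 c0.
exact: quadratic_factors_split hl c3 c2 c1 c0.
Qed.

End Depression.

(** * From finite covers to the Haar measure *)

Section Haar.
Variables (R : realType) (p : nat).
Hypothesis hp : prime p.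
Local Notation Zp := (Zpadic p).
Local Notation point := ('I_4 -> Zp).
Implicit Types (A : set point) (a : nat -> point).
Local Notation vol n := ((p%:R ^+ (4 * n))^-1 : R).

Lemma vol_gt0 n : 0 < vol n.
Proof. by rewrite invr_gt0 exprn_gt0 // ltr0n prime_gt0. Qed.

Lemma nneseries_le (u : nat -> R) (c : R) : (forall k, 0 <= u k) ->
  (forall n, \sum_(0 <= k < n) u k <= c) -> (\sum_(0 <= k <oo) (u k)%:E <= c%:E)%E.
Proof.
move=> u0 uc; apply: lime_le.
  by apply: is_cvg_nneseries => n _ _; rewrite lee_fin.
by apply: nearW => n; rewrite sumEFin lee_fin.
Qed.

(* Infinitely many balls must be listed: beyond [K], they are taken of total volume at
   most [e]. *)
Lemma haar4_le_finite A K a N e : 0 < e ->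
  (forall x, A x -> exists2 k, (k < K)%N & zp_ball4 (a k) N x) ->
  (haar4 R A <= (K%:R * vol N + e)%:E)%E.
Proof.
move=> e0 hA; have [M hM] : exists M, (2 ^+ M)^-1 <= e.
  have h0 : 0 <= e^-1 by rewrite invr_ge0 ltW.
  exists (Num.bound e^-1).
  rewrite -[leRHS]invrK lef_pV2 ?posrE ?invr_gt0 ?exprn_gt0 //.
  rewrite (le_trans (ltW (archi_boundP h0))) // -natrX ler_nat ltnW // ltn_expl //.
(* The additional balls have volume at most [2^-(M + k + 1)], and these sum to at most
   [2^-M <= e]. *)
pose N' k := if (k < K)%N then N else (M + k.+1)%N.
apply: ge_ereal_inf; exists (\sum_(0 <= k <oo) (vol (N' k))%:E)%E.
  exists a, N'; split=> // x /hA [k kK hx]; exists k => //.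
  by rewrite /N' kK.
apply: nneseries_le => [k|n]; first exact/ltW/vol_gt0.
have hb k : vol (N' k) <= (if (k < K)%N then vol N else 0) + (2 ^+ (M + k.+1))^-1.
  rewrite /N'; case: (k < K)%N; first by rewrite lerDl invr_ge0 exprn_ge0.
  rewrite add0r lef_pV2 ?posrE ?exprn_gt0 ?ltr0n ?prime_gt0 //.
  rewrite (@le_trans _ _ (p%:R ^+ (M + k.+1))) //.
    by rewrite lerXn2r ?nnegrE // ler_nat prime_gt1.
  by rewrite ler_weXn2l ?ler1n ?prime_gt0 // mulSn leq_addr.
apply: (le_trans (ler_sum _ (fun k _ => hb k))).
rewrite big_split lerD //=.
  rewrite -big_mkcond /=.
  have -> : \sum_(0 <= i < n | (i < K)%N) vol N = vol N *+ minn n K.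
    elim: n => [|n ih]; first by rewrite big_geq // min0n.
    rewrite big_mkcond big_nat_recr //= -big_mkcond ih; case: ltnP => h.
      by rewrite !(minn_idPl _) ?mulrSr // ltnW.
    by rewrite addr0 !(minn_idPr _) // ltnW.
  rewrite -[leLHS]mulr_natl ler_wpM2r ?ler_nat ?geq_minr //.
apply: le_trans hM.
suff -> : \sum_(0 <= k < n) (2 ^+ (M + k.+1))^-1 = (2 ^+ M)^-1 - (2 ^+ (M + n))^-1 :> R.
  by rewrite gerBl invr_ge0 exprn_ge0.
elim: n => [|n ih]; first by rewrite big_geq // addn0 subrr.
rewrite big_nat_recr //= ih addnS exprS; field.
by rewrite !expf_neq0.
Qed.

(** Counting at the largest level [m]: a ball of level [N k] contains at most [p^(4 (m - N k))] of
    the [p^(4 m)] classes modulo [p^m]. *)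
Lemma finite_cover_vol K a (N : nat -> nat) :
  (forall x, exists2 k, (k < K)%N & zp_ball4 (a k) (N k) x) ->
  1 <= \sum_(0 <= k < K) vol (N k).
Proof.
move=> h; pose m := \max_(k < K) N k.
have hm (k : 'I_K) : (N k <= m)%N by apply: leq_bigmax.
pose T := {ffun 'I_4 -> 'I_(p ^ m)}.
pose S (k : 'I_K) := [set r : T | [forall i, ((r i %% p ^ N k)%N%:Z == zpval (a k i) (N k))]].
have cardT : #|{: T}| = (p ^ (4 * m))%N by rewrite card_ffun !card_ord -expnM mulnC.
have cover_S : (#|{: T}| <= \sum_(k < K) #|S k|)%N.
  rewrite -sum1_card (@leq_trans (\sum_(r : T) \sum_(k < K) (r \in S k))%N) //.
    apply: leq_sum => r _; have [k kK hk] := h (fun i => (r i : nat)%:R).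
    rewrite (bigD1 (Ordinal kK)) //= (_ : _ \in _ = true) // inE.
    by apply/forallP => i; rewrite -(hk i) zpval_nat zp_modE // modz_nat.
  rewrite exchange_big; apply: leq_sum => k _.
  by rewrite -sum1_card [leqRHS]big_mkcond; apply: leq_sum => r _; case: (_ \in _).
have card_S k : (#|S k| <= p ^ (4 * (m - N k)))%N.
  have pf (r : T) i : (r i %/ p ^ N k < p ^ (m - N k))%N.
    by rewrite ltn_divLR ?expn_gt0 ?prime_gt0 // -expnD subnK.
  pose f (r : T) : {ffun 'I_4 -> 'I_(p ^ (m - N k))} := [ffun i => Ordinal (pf r i)].
  have fi : {in S k &, injective f}.
    move=> r r'; rewrite !inE => /forallP hr /forallP hr' e; apply/ffunP => i.
    apply: val_inj; rewrite /= (divn_eq (r i) (p ^ N k)) (divn_eq (r' i) (p ^ N k)).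
    have := congr1 (fun g : {ffun 'I_4 -> 'I_(p ^ (m - N k))} => val (g i)) e; rewrite !ffunE /= => ->.
    congr (_ + _)%N; apply/eqP; rewrite -eqz_nat (eqP (hr i)) (eqP (hr' i)) //.
  rewrite -(card_in_imset fi) (leq_trans (max_card _)) //.
  by rewrite card_ffun !card_ord -expnM mulnC.
have hT : (p ^ (4 * m) <= \sum_(k < K) p ^ (4 * (m - N k)))%N.
  by rewrite -cardT (leq_trans cover_S) // leq_sum.
rewrite big_mkord; move: hT; rewrite -(ler_nat R) natr_sum natrX => hT.
have p0 : p%:R != 0 :> R by rewrite pnatr_eq0 -lt0n prime_gt0.
have pm0 : 0 < p%:R ^+ (4 * m) :> R by rewrite exprn_gt0 // ltr0n prime_gt0.
rewrite -(ler_pM2l pm0) mulr1 mulr_sumr (le_trans hT) // ler_sum // => k _.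
rewrite natrX -[in leRHS](subnK (hm k)) mulnDr exprD mulfK // expf_neq0 //.
Qed.

(** A ball with no finite subcover has a child with none, and such nested balls shrink to a
    point. *)
Lemma zp4_compact a (N : nat -> nat) :
  (forall x, exists k, zp_ball4 (a k) (N k) x) ->
  exists K, forall x, exists2 k, (k < K)%N & zp_ball4 (a k) (N k) x.
Proof.
move=> hcov; pose good (c : point) n := exists K, forall x, zp_ball4 c n x ->
  exists2 k, (k < K)%N & zp_ball4 (a k) (N k) x.
suff [K hK] : good (fun=> 0) 0%N.
  exists K => x; apply: hK => i; rewrite -(zp_vmod (x i)) -[RHS]zp_vmod.
  by rewrite zp_modE // expn0 !modz1.
apply: contrapT => bad0.
have /choice [next hnext] : forall cn : point * nat, exists c' : point, ~ good cn.1 cn.2 ->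
    zp_ball4 cn.1 cn.2 c' /\ ~ good c' cn.2.+1.
  move=> [c n] /=; apply: contrapT => hno; have {}hno : ~ good c n /\ forall c', zp_ball4 c n c' -> good c' n.+1.
    split=> [hg|c' hc']; first by apply: hno; exists c => /(_ hg).
    by apply: contrapT => hb; apply: hno; exists c'.
  case: hno => hb hg; apply: hb.
  pose child (r : {ffun 'I_4 -> 'F_p}) : point := fun i => c i + p%:R ^+ n * zp_lift (r i).
  have hchild r : zp_ball4 c n (child r).
    by move=> i; apply/(congruent_zpval hp); exists (zp_lift (r i)).
  have /choice [Kf hKf] := fun r => hg _ (hchild r).
  exists (\max_r Kf r)%N => x hx.
  have /choice [y hy] : forall i, exists y, x i = c i + p%:R ^+ n * y.
    by move=> i; apply/(congruent_zpval hp); apply: hx.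
  pose r := [ffun i => zp_res hp (y i)].
  have [k kK hk] : exists2 k, (k < Kf r)%N & zp_ball4 (a k) (N k) x.
    apply: hKf => i; apply/(congruent_zpval hp).
    have [z hz] := res_split (zp_henselian hp) (erefl (zp_res hp (y i))).
    by exists z; rewrite hy {1}hz /child ffunE exprS; ring.
  by exists k => //; apply: (leq_trans kK); apply: leq_bigmax.
pose c n := iteri n (fun m b => next (b, m)) (fun=> 0).
have hc n : ~ good (c n) n.
  by elim: n => [|n ih] //; have [] := hnext (c n, n) ih.
have hcc n : zp_ball4 (c n) n (c n.+1) by have [] := hnext (c n, n) (hc n).
have /choice [x hx] : forall i, exists x : Zp, forall n, zpval x n = zpval (c n i) n.
  by move=> i; apply: (zp_limit (a := fun n => c n i)) => n; apply: hcc.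
(* The ball of the cover that contains the limit [x] has level [N k] and coincides with the bad ball
   of that level. *)
have [k hk] := hcov x; apply: (hc (N k)); exists k.+1 => z hz; exists k => // i.
by rewrite hz -hx hk.
Qed.

(* Adding the [K] balls to a cover of [A] gives a cover of the whole space, of volume at
   least 1 by compactness. *)
Lemma haar4_ge_finite A K b M :
  (forall x, ~ A x -> exists2 k, (k < K)%N & zp_ball4 (b k) M x) ->
  ((1 - K%:R * vol M)%:E <= haar4 R A)%E.
Proof.
move=> hb; apply: le_ereal_inf_tmp => s [a [N [hA ->]]].
pose a' k := if (k < K)%N then b k else a (k - K)%N.
pose N' k := if (k < K)%N then M else N (k - K)%N.
have [|L hL] := @zp4_compact a' N'.
  move=> x; case: (pselect (A x)) => [/hA [k _ hk]|/hb [k kK hk]].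
    by exists (k + K)%N; rewrite /a' /N' ltnNge leq_addl /= addnK.
  by exists k; rewrite /a' /N' kK.
have hL' : forall x, exists2 k, (k < K + L)%N & zp_ball4 (a' k) (N' k) x.
  by move=> x; have [k kL hk] := hL x; exists k => //; apply: (leq_trans kL); apply: leq_addl.
have := finite_cover_vol hL'.
rewrite (big_cat_nat (n := K)) ?leq_addr //= (eq_big_nat _ _ (F2 := fun=> vol M)); last first.
  by move=> k /andP[_ kK]; rewrite /N' kK.
rewrite sumr_const_nat subn0 -[_ *+ K]mulr_natl.
have -> : \sum_(K <= k < (K + L)%N) vol (N' k) = \sum_(0 <= k < L) vol (N k).
  rewrite -{1}[K]add0n big_addn addKn; apply: eq_bigr => k _.
  by rewrite /N' ltnNge leq_addl /= addnK.
move=> h; apply: (@le_trans _ _ (\sum_(0 <= k < L) (vol (N k))%:E)%E).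
  by rewrite sumEFin lee_fin lerBlDl.
by apply: nneseries_lim_ge => k _ _; rewrite lee_fin ltW // vol_gt0.
Qed.

(** The shift [u] is unconstrained: its [p^N0] residues multiply the boxes in [(v, s, t)], and the
    volume [p^(-4 N0)] of a ball compensates for all four coordinates. *)
Lemma cover_points (hodd : odd p) P m : box_cover 'F_p (p%:R : Zp) P m ->
  exists K b N, K%:R * vol N <= m /\
    forall u v s t, P v s t -> exists2 k, (k < K)%N & zp_ball4 (b k) N (undepress u v s t).
Proof.
case=> N0 h; have [L [hL cL]] := h _ _ _ (leqnn N0) (leqnn N0) (leqnn N0).
have [L0 [sL0 cL0]] := residues (zp_henselian hp) N0.
pose B := [seq undepress u x.1.1 x.1.2 x.2 | u <- L0, x <- L].
exists (size B), (fun k => nth (fun=> 0) B k), N0; split.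
  rewrite size_allpairs sL0 natrM card_Fp // natrX ler_pdivrMr; last first.
    by rewrite exprn_gt0 // ltr0n prime_gt0.
  rewrite (mulnDl 1 3 N0) mul1n exprD mulrCA ler_wpM2l ?exprn_ge0 //.
  by move: hL; rewrite card_Fp // (_ : N0 + N0 + N0 = 3 * N0)%N //; lia.
move=> u v s t /cL [x xL [c1 c2 c3]]; have [w wL0 cw] := cL0 u.
have hB : undepress w x.1.1 x.1.2 x.2 \in B.
  exact: (allpairs_f (fun u (x : Zp * Zp * Zp) => undepress u x.1.1 x.1.2 x.2)).
exists (index (undepress w x.1.1 x.1.2 x.2) B); first by rewrite index_mem.
rewrite nth_index // => i; apply/(congruent_zpval hp).
exact: congruent_undepress.
Qed.

Lemma haar4_irreducible (hodd : odd p) :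
  haar4 R [set c : point | zp_irreducible (monic_quartic c)] =
  (irreducible_density R 'F_p)%:E.
Proof.
have hcov := irreducible_near (R := R) (zp_henselian hp) (Fp_two_neq0 hp hodd).
have irrE (u v s t : Zp) : zp_irreducible (monic_quartic (undepress u v s t)) <-> ~ splits v s t.
  split=> [hi hs|hs]; first exact: splits_reducible hs hi.
  by apply: contrapT => hn; apply: hs; apply: (reducible_splits hp hodd hn).
apply/eqP; rewrite eq_le; apply/andP; split; apply/lee_addgt0Pr => e e0.
  (* Half of [e] pays for the error of the cover, half for the infinitely many additional balls. *)
  have e2 : 0 < e / 2 by rewrite divr_gt0.
  have [/(cover_points hodd) [K [b [N [hK hb]]]] _] := hcov _ e2.
  apply: (le_trans (haar4_le_finite (K := K) (a := b) (N := N) e2 _)).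
    move=> c; have [u [v [s [t ->]]]] := undepress_surj hp hodd c.
    by move/irrE; apply: hb.
  by rewrite lee_fin; lra.
have [_ /(cover_points hodd) [K [b [N [hK hb]]]]] := hcov _ e0.
have hlow := @haar4_ge_finite [set c : point | zp_irreducible (monic_quartic c)] K b N.
apply: (@le_trans _ _ ((1 - K%:R * vol N)%:E + e%:E)%E).
  by rewrite -EFinD lee_fin; lra.
rewrite leeD2r //; apply: hlow => c; have [u [v [s [t ->]]]] := undepress_surj hp hodd c.
by move=> hn; apply: hb => /irrE /hn.
Qed.

End Haar.

Theorem theorem7 (R : realType) (p : nat) (hp : prime p) (hodd : odd p) :
  haar4 R [set c : 'I_4 -> Zpadic p | zp_irreducible (monic_quartic c)] =
  (let x : R := p%:R in
   (x ^+ 12 + x ^+ 11 + 2 * x ^+ 10 + 4 * x ^+ 9 - 2 * x ^+ 8 + x ^+ 7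
    + 3 * x ^+ 6 - 6 * x ^+ 5 + 6 * x ^+ 4 - 4 * x ^+ 3 - 2 * x ^+ 2 - 4)
   / (4 * (x + 1) * (x ^+ 2 + 1) * (x ^+ 9 - 1)))%:E.
Proof.
by rewrite haar4_irreducible // /irreducible_density card_Fp.
Qed.
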